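(* Let $\mathcal{A}\subset\mathbb{R}^d$ be a finite set of points in general position, and consider an incremental convex hull algorithm run on $\mathcal{A}$ (as described in the context). Let $t$ be the number of cells of the triangulation of $\operatorname{conv}(\mathcal{A})$ constructed by the algorithm. Then the sequence of orientation predicates of the algorithm can be evaluated in such a way that the first orientation predicate is computed in $O(d^{\omega})$ time, every other orientation predicate is computed in $O(d^2)$ time, and the total space used is $O(d^2 t)$.
   Context: Time is the number of arithmetic operations ($+,-,\times,/$) and sign tests on numbers, each at unit cost; space is the number of numbers stored (besides the given input) in order to evaluate the predicates. The exponent $\omega>2$ is such that two $d\times d$ matrices over a field can be multiplied in $O(d^{\omega})$ arithmetic operations. Implied constants are absolute (depending only on the chosen matrix multiplication algorithm). General position: every $d+1$ points of $\mathcal{A}$ are affinely independent. A cell is a $d$-simplex spanned by $d+1$ points of $\mathcal{A}$; a triangulation of a point set is a collection of such simplices whose union is the convex hull of the set and any two of which intersect in a common face or not at all. A facet of a cell (or of the triangulation) is a $(d-1)$-face of a cell. Orientation matrix: for an (ordered) set $C=\{c_1,\dots,c_{d+1}\}\subset\mathbb{R}^d$, $A_C$ is the $(d+1)\times(d+1)$ matrix whose $i$-th column is the homogeneous vector $(c_i,1)$. An orientation predicate on $C$ is the evaluation of $\det(A_C)$ and its sign. Incremental convex hull algorithm: the algorithm starts with a $d$-simplex of $\mathcal{A}$ (the first cell), whose orientation matrix gives the first orientation predicate. It then inserts the remaining points one by one, maintaining a triangulation $T$ of the convex hull of the points inserted so far; cells are never removed. When a new point $a$ is inserted, the algorithm evaluates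 orientation predicates on sets $F\cup\{a\}$, where $F$ is the vertex set of a facet of an already existing cell $C=F\cup\{u\}$ of $T$. (The facet $F$, when on the boundary of the current hull, is visible from $a$ iff $\det(A_C)$ and $\det(A_{F\cup\{a\}})$ have opposite signs, where $A_{F\cup\{a\}}$ is obtained from $A_C$ by replacing the column of $u$ by that of $a$.) For every boundary facet $F$ visible from $a$, the new cell $F\cup\{a\}$ is added to $T$. The algorithm may keep, with every cell $C$ of $T$, numerical data such as $\det(A_C)$ and the adjoint (adjugate) matrix $A_C^{\mathrm{adj}}=\det(A_C)A_C^{-1}$. The representative example is the Beneath-and-Beyond algorithm, in which the points are inserted in increasing lexicographic order of coordinates. *)

(* Defs.v *)
From HB Require Import structures.
From mathcomp Require Export all_boot all_order all_algebra finmap.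
From mathcomp Require Export all_classical all_reals topology normedtype exp.

Set Implicit Arguments.
Unset Strict Implicit.
Unset Printing Implicit Defensive.

Export Order.TTheory GRing.Theory Num.Theory.
Export numFieldNormedType.Exports.

#[export] Set Implicit Arguments.
#[export] Unset Strict Implicit.
#[export] Unset Printing Implicit Defensive.

Open Scope classical_set_scope.
Open Scope ring_scope.

(** A program works on numbers kept in registers.  Its operands are the input
    numbers (indexed by [I], read-only), registers, and constants of the field,
    as in arithmetic circuits.  Constants are fixed with the program, before
    the input is known.  Control is not charged: a program is a decision tree
    that branches only on the signs it has tested. *)

Variant operand (R : realType) (I : Type) :=
  | Input of I
  | Reg of nat
  | Const of R.
Arguments Reg {R I} r.
Arguments Const {R I} c.

Variant arith_op := Add | Sub | Mul | Div.

Inductive program (R : realType) (I X : Type) :=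
  | Return of X
  | Op of arith_op & nat & operand R I & operand R I & program R I X
  | SignTest of operand R I & (int -> program R I X).

(** A finite map, so that its domain is the set of registers holding a number. *)
Definition memory (R : realType) := {fmap nat -> R}.

(** Registers are never released, so the number of registers in use at the end
    of an execution is the largest number of numbers stored during it. *)
Definition space_used (R : realType) (m : memory R) : nat := #|` domf m|%fset.

Definition value (R : realType) (I : Type) (inp : I -> R) (m : memory R)
    (x : operand R I) : option R :=
  match x with
  | Input i => Some (inp i)
  | Reg r => m.[? r]%fmap
  | Const c => Some c
  end.

Definition arith (R : realType) (o : arith_op) (x y : R) : option R :=
  match o with
  | Add => Some (x + y)
  | Sub => Some (x - y)
  | Mul => Some (x * y)
  | Div => if y == 0 then None else Some (x / y)
  end.

(** [exec inp P m] is [Some (v, m', t)] when [P], started in memory [m],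
    returns [v] in memory [m'] after [t] arithmetic operations and sign tests.
    It is [None] if a register is read before being written, or if a division
    by zero occurs. *)
Fixpoint exec (R : realType) (I X : Type) (inp : I -> R) (P : program R I X)
    (m : memory R) : option (X * memory R * nat) :=
  match P with
  | Return v => Some (v, m, 0%N)
  | Op o r x y P' =>
      match value inp m x, value inp m y with
      | Some a, Some b =>
          match arith o a b with
          | Some c =>
              omap (fun res => (res.1, res.2.+1)) (exec inp P' m.[r <- c]%fmap)
          | None => None
          end
      | _, _ => None
      end
  | SignTest x P' =>
      match value inp m x with
      | Some a => omap (fun res => (res.1, res.2.+1)) (exec inp (P' (sgz a)) m)
      | None => None
      end
  end.

Fixpoint straight_line (R : realType) (I X : Type) (P : program R I X) : bool :=
  match P with
  | Return _ => true
  | Op _ _ _ _ P' => straight_line P'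
  | SignTest _ _ => false
  end.

(** Two [k] x [k] matrices can be multiplied in O(k ^ omega) arithmetic
    operations (and no sign tests).  Nothing is assumed about the space. *)
Definition matmul_exponent (R : realType) (omega : R) : Prop :=
  exists c : R, forall k : nat, (0 < k)%N ->
  exists P : program R ('I_k * 'I_k + 'I_k * 'I_k)
               ('I_k -> 'I_k -> operand R ('I_k * 'I_k + 'I_k * 'I_k)),
    straight_line P /\
    forall A B : 'M[R]_k,
    let inp e := match e with inl ij => A ij.1 ij.2 | inr ij => B ij.1 ij.2 end in
    exists out m t,
      [/\ exec inp P [fmap]%fmap = Some (out, m, t),
          forall i j, value inp m (out i j) = Some ((A *m B) i j)
        & t%:R <= c * k%:R `^ omega].

(** The point set is given as a family [p], and its points are referred to by
    their indices. *)

Definition affinely_independent (R : realType) (d k : nat)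
    (c : 'I_k -> 'rV[R]_d) : Prop :=
  forall l : 'I_k -> R, \sum_i l i = 0 -> \sum_i l i *: c i = 0 ->
  forall i, l i = 0.

Definition general_position (R : realType) (d n : nat) (p : 'I_n -> 'rV[R]_d) :
    Prop :=
  forall f : 'I_d.+1 -> 'I_n, injective f -> affinely_independent (p \o f).

Definition conv (R : realType) (d n : nat) (p : 'I_n -> 'rV[R]_d)
    (S : {set 'I_n}) : set 'rV[R]_d :=
  [set x | exists w : 'I_n -> R,
     [/\ forall i, 0 <= w i, forall i, i \notin S -> w i = 0,
         \sum_i w i = 1 & x = \sum_i w i *: p i]].

(** The vertices of a cell are listed in some order, which fixes the order of
    the columns of its orientation matrix. *)
Definition cell (d n : nat) := {ffun 'I_d.+1 -> 'I_n}.

Definition vertices (d n : nat) (C : cell d n) : {set 'I_n} :=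
  [set C j | j : 'I_d.+1]%SET.

(** The facet opposite to the [i]-th vertex. *)
Definition facet (d n : nat) (C : cell d n) (i : 'I_d.+1) : {set 'I_n} :=
  [set C j | j : 'I_d.+1 & j != i]%SET.

(** For [F := facet C i] this is F U {a}, with [a] in the place of [C i]. *)
Definition replace (d n : nat) (C : cell d n) (i : 'I_d.+1) (a : 'I_n) :
    cell d n :=
  [ffun j => if j == i then a else C j].

(** The homogeneous vector (x, 1): the last coordinate is the one that
    [unlift ord_max] sends to [None]. *)
Definition homog (R : realType) (d : nat) (x : 'rV[R]_d) : 'cV[R]_d.+1 :=
  \col_r oapp (fun k : 'I_d => x 0 k) 1 (unlift ord_max r).

Definition orientation_matrix (R : realType) (d n : nat) (p : 'I_n -> 'rV[R]_d)
    (C : cell d n) : 'M[R]_d.+1 :=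
  \matrix_(r, i) homog (p (C i)) r 0.

Definition orientation (R : realType) (d n : nat) (p : 'I_n -> 'rV[R]_d)
    (C : cell d n) : R :=
  \det (orientation_matrix p C).

(** [T] triangulates the convex hull of the points in [S]; not all these points
    need be vertices of [T].  Two cells meet in a common face, the case of an
    empty intersection being [G = set0]. *)
Definition triangulation (R : realType) (d n : nat) (p : 'I_n -> 'rV[R]_d)
    (S : {set 'I_n}) (T : {set cell d n}) : Prop :=
  [/\ forall C, C \in T -> injective C /\ vertices C \subset S,
      {in T &, injective (@vertices d n)},
      (forall x, conv p S x <-> exists2 C, C \in T & conv p (vertices C) x)
    & forall C D, C \in T -> D \in T ->
      exists G : {set 'I_n}, G \subset vertices C :&: vertices D /\
        conv p (vertices C) `&` conv p (vertices D) = conv p G].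

Definition on_boundary (R : realType) (d n : nat) (p : 'I_n -> 'rV[R]_d)
    (S : {set 'I_n}) (F : {set 'I_n}) : Prop :=
  conv p F `<=` conv p S `\` interior (conv p S).

Definition visible (R : realType) (d n : nat) (p : 'I_n -> 'rV[R]_d)
    (C : cell d n) (i : 'I_d.+1) (a : 'I_n) : Prop :=
  orientation p C * orientation p (replace C i a) < 0.

(** [Replace C i a] asks for the predicate on F U {a}, where F is the facet of
    the already existing cell [C] opposite to its [i]-th vertex. *)
Variant request (d n : nat) :=
  | Initial of cell d n
  | Replace of cell d n & 'I_d.+1 & 'I_n.

Definition target (d n : nat) (q : request d n) : cell d n :=
  match q with
  | Initial C => C
  | Replace C i a => replace C i a
  end.

(** [incremental p rs S T]: after the insertion of the points in [S], an
    incremental algorithm has requested the predicates [rs], in this order, and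
    has built the triangulation [T].  At the insertion of [a] it may evaluate
    predicates on any facets of the existing cells, in any order (and possibly
    repeatedly), but has to do so for the visible boundary facets, as this is
    how it finds the new cells.  The insertion order is arbitrary. *)
Inductive incremental (R : realType) (d n : nat) (p : 'I_n -> 'rV[R]_d) :
    seq (request d n) -> {set 'I_n} -> {set cell d n} -> Prop :=
  | incremental_start (C : cell d n) :
      injective C -> incremental p [:: Initial C] (vertices C) [set C]%SET
  | incremental_insert rs S T (a : 'I_n) (fs : seq (cell d n * 'I_d.+1))
      (T' : {set cell d n}) :
      incremental p rs S T ->
      a \notin S ->
      (forall f, f \in fs -> f.1 \in T) ->
      (forall C i, C \in T -> on_boundary p S (facet C i) -> visible p C i a ->
         (C, i) \in fs) ->
      (forall D, D \in T' <-> D \in T \/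
         exists C i, [/\ C \in T, on_boundary p S (facet C i),
                         visible p C i a & D = replace C i a]) ->
      triangulation p (a |: S) T' ->
      incremental p (rs ++ [seq Replace f.1 f.2 a | f <- fs]) (a |: S) T'.

(** An evaluation method chooses the program answering the last of the requests
    made so far, from these requests alone, and not from the coordinates of the
    points.  The program has to return an operand holding the determinant,
    together with its sign. *)
Definition evaluator (R : realType) (d n : nat) :=
  seq (request d n) ->
  program R ('I_n * 'I_d) (operand R ('I_n * 'I_d) * int).

(** [evaluates p ev rs ts m]: [ev] correctly answers the requests [rs] one
    after the other, in respective times [ts].  Memory is initially empty, is
    kept from one request to the next, and is [m] in the end. *)
Inductive evaluates (R : realType) (d n : nat) (p : 'I_n -> 'rV[R]_d)
    (ev : evaluator R d n) :
    seq (request d n) -> seq nat -> memory R -> Prop :=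
  | evaluates_nil : evaluates p ev [::] [::] [fmap]%fmap
  | evaluates_rcons rs ts m q o t m' :
      evaluates p ev rs ts m ->
      let inp ij := p ij.1 0 ij.2 in
      exec inp (ev (rcons rs q)) m =
        Some ((o, sgz (orientation p (target q))), m', t) ->
      value inp m' o = Some (orientation p (target q)) ->
      evaluates p ev (rcons rs q) (rcons ts t) m'.

(* Main.v *)
(** Each cell that is used stores the inverse of its orientation matrix and its
    determinant.  Replacing a column [u] of [A] by [a] multiplies the
    determinant by the corresponding coordinate of [A^-1 a], and changes the
    inverse by a rank one matrix, so a predicate on [F U {a}] costs [O(d)] and
    the data of the new cell [O(d^2)].  The data of a cell are only computed when
    it is first used: a cell of the triangulation arose from a request on an
    older cell, which has its data by then.  Hence at most one block of
    [O(d^2)] numbers per cell, although interior facets and repeated requests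
    make the number of requests unbounded in terms of [t].

    The first inverse and determinant come from recursive elimination on halves
    of the rows, with pivoting by sign tests and with Schur complements formed by
    fast matrix products.  The given multiplication program may use space
    [d^omega]; the bilinear part of its second order expansion at the origin is
    a decomposition of the matrix multiplication tensor, free of divisions, and
    one level of blocking with this decomposition reduces the space to
    [O(d^2)]. *)

Require Import Defs.
From mathcomp Require Import perm sequences zify ring lra.

(** * Programs and the registers they write *)

Local Open Scope nat_scope.

Section Programs.
Variables (R : realType) (I : Type) (inp : I -> R).
Implicit Types (m : memory R) (a b : nat).

(** As [t] may be 1, the first predicate alone has to fit in [O(d^2)] registers, so a time bound for
    the matrix product is not enough. The given program cannot simply be run on matrices whose
    entries are blocks, since it may divide and may rely on commutativity; a bilinear decomposition
    can. The expansion behind it exists because the program succeeds on every input: at the origin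
    all divisors are nonzero. Elimination has to choose columns, because leading minors of an
    orientation matrix may vanish. Halving only the rows leaves wide matrices of full row rank, a
    property inherited by the upper half and by its Schur complement. The chosen columns are known
    at each leaf of the decision tree, so they can be used as addresses, and the sign of their
    permutation is a constant. An evaluator sees the requests but not the points, so the address of
    every block has to be a function of the request history. *)

Fixpoint bind (X Y : Type) (P : program R I X) (f : X -> program R I Y) :
    program R I Y :=
  match P with
  | Return v => f v
  | Op o r x y P' => Op o r x y (bind P' f)
  | SignTest x P' => SignTest x (fun z => bind (P' z) f)
  end.

Lemma exec_bind X Y (P : program R I X) (f : X -> program R I Y) m v m' t :
  exec inp P m = Some (v, m', t) ->
  exec inp (bind P f) m =
    omap (fun res => (res.1, t + res.2)) (exec inp (f v) m').
Proof.
elim: P m t => [w|o r x y P IH|x P IH] m t /=.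
- by case=> -> -> <-; case: exec => [[]|].
- case: value => // c1; case: value => // c2; case: arith => // c.
  case E: exec => [[[w m1] t1]|] //= [hw hm <-]; rewrite hw hm in E.
  by rewrite (IH _ _ E); case: exec => [[]|].
- case: value => // c; case E: exec => [[[w m1] t1]|] //= [hw hm <-].
  rewrite hw hm in E.
  by rewrite (IH _ _ _ E); case: exec => [[]|].
Qed.

Definition outside a b m m' :=
  forall r, (r < a) || (b <= r) -> m'.[? r]%fmap = m.[? r]%fmap.

Definition avoids a b (x : operand R I) : bool :=
  if x is Reg r then (r < a) || (b <= r) else true.

(** The operand is also required to lie outside [[a, b)], the registers about to be written, so that
    its value survives the writes. *)
Definition holds a b m x (c : R) := avoids a b x /\ value inp m x = Some c.

(** A total-correctness triple with a time bound [T] and a frame: only registers in [[a, b)] may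
    change. *)
Definition runs X m (P : program R I X) a b T (Q : X -> memory R -> Prop) :=
  exists v m' t,
    [/\ exec inp P m = Some (v, m', t), t <= T, outside a b m m' & Q v m'].

Lemma outside_sub a b a' b' m m' :
  a' <= a -> b <= b' -> outside a b m m' -> outside a' b' m m'.
Proof. by move=> ha hb h r hr; apply: h; lia. Qed.

Lemma outside_trans a b m1 m2 m3 :
  outside a b m1 m2 -> outside a b m2 m3 -> outside a b m1 m3.
Proof. by move=> h h' r hr; rewrite h' ?h. Qed.

Lemma holds_sub a b a' b' m x c :
  a <= a' -> b' <= b -> holds a b m x c -> holds a' b' m x c.
Proof. by move=> ha hb [hx hv]; split=> //; case: x hx {hv} => //= r; lia. Qed.

Lemma holds_outside a b a' b' m m' x c :
  a <= a' -> b' <= b -> outside a' b' m m' -> holds a b m x c ->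
  holds a b m' x c.
Proof.
move=> ha hb h [hx hv]; split=> //; case: x hx hv => //= r hr <-.
by rewrite h //; lia.
Qed.

Lemma holds_reg a b m r c :
  (r < a) || (b <= r) -> m.[? r]%fmap = Some c -> holds a b m (Reg r) c.
Proof. by []. Qed.

Lemma holds_const a b m c : holds a b m (Const c) c.
Proof. by []. Qed.

Lemma runs_return X (v : X) m a b (Q : X -> memory R -> Prop) :
  Q v m -> runs m (Return R I v) a b 0 Q.
Proof. by move=> h; exists v, m, 0. Qed.

Lemma runs_weaken X m (P : program R I X) a b a' b' T T'
    (Q Q' : X -> memory R -> Prop) :
  runs m P a b T Q -> a' <= a -> b <= b' -> T <= T' ->
  (forall v m', outside a b m m' -> Q v m' -> Q' v m') ->
  runs m P a' b' T' Q'.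
Proof.
move=> [v [m' [t [hE ht ho hQ]]]] ha hb hT hQ'; exists v, m', t; split=> //.
- exact: leq_trans hT.
- exact: outside_sub ho.
- exact: hQ'.
Qed.

Lemma runs_bind X Y m (P : program R I X) (f : X -> program R I Y) a b a1 b1
    T1 T2 T (Q1 : X -> memory R -> Prop) (Q2 : Y -> memory R -> Prop) :
  runs m P a1 b1 T1 Q1 -> a <= a1 -> b1 <= b ->
  (forall v m', outside a1 b1 m m' -> Q1 v m' -> runs m' (f v) a b T2 Q2) ->
  T1 + T2 <= T ->
  runs m (bind P f) a b T Q2.
Proof.
move=> [v [m1 [t1 [hE1 ht1 ho1 hQ1]]]] ha hb hf hT.
have [w [m2 [t2 [hE2 ht2 ho2 hQ2]]]] := hf _ _ ho1 hQ1.
exists w, m2, (t1 + t2); split=> //.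
- by rewrite (exec_bind _ hE1) hE2.
- exact: leq_trans (leq_add ht1 ht2) hT.
- exact: outside_trans (outside_sub ha hb ho1) ho2.
Qed.

Fixpoint loop (n : nat) (body : nat -> program R I unit) : program R I unit :=
  if n is n'.+1 then bind (loop n' body) (fun _ => body n')
  else Return R I tt.

Lemma runs_loop n body a b T (Inv : nat -> memory R -> Prop) m :
  Inv 0 m ->
  (forall i m', i < n -> outside a b m m' -> Inv i m' ->
     runs m' (body i) a b T (fun _ => Inv i.+1)) ->
  runs m (loop n body) a b (n * T) (fun _ => Inv n).
Proof.
move=> h0; elim: n => [|n IH] h /=; first exact: runs_return.
apply: (runs_bind (IH _)) => //; last by rewrite mulSn addnC.
  by move=> i m' hi; apply: h; apply: ltnW.
by move=> _ m' ho hI; apply: h.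
Qed.

Lemma runs_op X m o r x y a b T (P : program R I X) u v c
    (Q : X -> memory R -> Prop) :
  value inp m x = Some u -> value inp m y = Some v -> arith o u v = Some c ->
  a <= r < b -> runs m.[r <- c]%fmap P a b T Q ->
  runs m (Op o r x y P) a b T.+1 Q.
Proof.
move=> hx hy hc hr [w [m' [t [hE ht ho hQ]]]].
exists w, m', t.+1; split=> //=; first by rewrite hx hy hc hE.
move=> i hi; rewrite ho // fnd_set; case: eqP => // E; lia.
Qed.

Definition fill n dst (o : nat -> arith_op) (x y : nat -> operand R I) :=
  loop n (fun i => Op (o i) (dst + i) (x i) (y i) (Return R I tt)).

(** A register may be overwritten using its old value, hence the hypothesis that
    only the destinations of the preceding entries are avoided. *)
Lemma runs_fill n dst o x y (u v c : nat -> R) m :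
  (forall i, i < n ->
     [/\ holds dst (dst + i) m (x i) (u i), holds dst (dst + i) m (y i) (v i)
       & arith (o i) (u i) (v i) = Some (c i)]) ->
  runs m (fill n dst o x y) dst (dst + n) n
    (fun _ m' => forall i, i < n -> m'.[? dst + i]%fmap = Some (c i)).
Proof.
move=> h.
pose Inv k m' := outside dst (dst + k) m m' /\
  forall i, i < k -> m'.[? dst + i]%fmap = Some (c i).
rewrite -[X in runs _ _ _ _ X]muln1.
apply: (@runs_weaken _ _ _ dst (dst + n) _ _ (n * 1) _ (fun _ => Inv n)) => //;
  last by move=> _ m' _ [].
apply: runs_loop; first by split=> // r; rewrite addn0.
move=> i m' hi _ [ho hc]; have [hx hy ha] := h i hi.
have [_ hx'] := holds_outside (leqnn _) (leqnn _) ho hx.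
have [_ hy'] := holds_outside (leqnn _) (leqnn _) ho hy.
apply: (runs_op hx' hy' ha); first lia.
apply: runs_return; split=> [r hr|k hk]; rewrite fnd_set.
  by case: eqP => [E|_]; [lia|apply: ho; lia].
rewrite eqn_add2l; case: eqP => [->//|E]; apply: hc; lia.
Qed.

(** All [n] sums advance together: accumulators from [s] on, the products of the current round in
    the next [n] registers. The space is [2 n] for every [N]. *)
Definition sum_of_products s n N (x y : nat -> nat -> operand R I) :=
  bind (fill n s (fun=> Add) (fun=> Const 0%R) (fun=> Const 0%R)) (fun=>
  loop N (fun l =>
    bind (fill n (s + n) (fun=> Mul) (x l) (y l)) (fun=>
    fill n s (fun=> Add) (fun i => Reg (s + i)) (fun i => Reg (s + n + i))))).

Lemma runs_sum_of_products s n N x y (u v : nat -> nat -> R) m :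
  (forall l i, l < N -> i < n ->
     holds s (s + n + n) m (x l i) (u l i) /\
     holds s (s + n + n) m (y l i) (v l i)) ->
  runs m (sum_of_products s n N x y) s (s + n + n) (n + N * (n + n))
    (fun _ m' => forall i, i < n ->
       m'.[? s + i]%fmap = Some (\sum_(l < N) u l i * v l i)%R).
Proof.
move=> h.
pose Inv k m' := forall i, i < n ->
  m'.[? s + i]%fmap = Some (\sum_(l < k) u l i * v l i)%R.
apply: (runs_bind (T2 := N * (n + n)) (Q2 := fun=> Inv N)
  (runs_fill (u := fun=> 0%R) (v := fun=> 0%R) (c := fun=> 0%R) _)) => //.
- by move=> i hi; split=> //=; rewrite addr0.
- lia.
move=> _ m0 ho0 h0; apply: runs_loop.
  by move=> i hi; rewrite big_ord0; apply: h0.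
move=> l m1 hl ho1 hI.
apply: (runs_bind (T2 := n) (runs_fill (u := u l) (v := v l)
  (c := fun i => (u l i * v l i)%R) _)).
- move=> i hi; have [hx hy] := h l i hl hi.
  split=> //; apply: (holds_sub (a := s) (b := s + n + n)); try lia.
    apply: (holds_outside _ _ ho1) => //.
    by apply: (holds_outside _ _ ho0) => //; lia.
  apply: (holds_outside _ _ ho1) => //.
  by apply: (holds_outside _ _ ho0) => //; lia.
- lia.
- lia.
- move=> _ m2 ho2 h2.
  apply: (runs_weaken (runs_fill (u := fun i => (\sum_(l < l) u l i * v l i)%R)
    (v := fun i => (u l i * v l i)%R)
    (c := fun i => (\sum_(l < l.+1) u l i * v l i)%R) _)) => //; last first.
  + lia.
  + move=> i hi; split.
    * by apply: holds_reg; [lia|rewrite ho2 ?hI//; lia].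
    * by apply: holds_reg; [lia|rewrite h2].
    * by rewrite /= big_ord_recr.
- lia.
Qed.

End Programs.

(** * Running a straight-line program as a subroutine *)

Section Embedding.
Variables (R : realType) (I J : Type) (inp : I -> R) (inpJ : J -> R).
Variables (g : J -> operand R I) (rho : nat -> nat).

Definition translate (x : operand R J) : operand R I :=
  match x with
  | Input j => g j
  | Reg r => Reg (rho r)
  | Const c => Const c
  end.

Fixpoint embed X (P : program R J X) : program R I X :=
  match P with
  | Return v => Return R I v
  | Op o r x y P' => Op o (rho r) (translate x) (translate y) (embed P')
  | SignTest x P' => SignTest (translate x) (fun z => embed (P' z))
  end.

(** For a straight-line program the length of this list is the running time on every input, and it
    bounds the number of registers. The list stops at a sign test, as only straight-line programs
    are embedded. *)
Fixpoint targets X (P : program R J X) : seq nat :=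
  if P is Op _ r _ _ P' then r :: targets P' else [::].

Lemma exec_time X (P : program R J X) m v m' t :
  straight_line P -> exec inpJ P m = Some (v, m', t) -> t = size (targets P).
Proof.
elim: P m t => [w|o r x y P IH|//] m t /=; first by move=> _ [_ _ <-].
move=> hP; case: value => // c1; case: value => // c2; case: arith => // c.
by case E: exec => [[[w m1] t1]|] //= [hw hm <-];
  rewrite hw hm in E; rewrite (IH _ _ hP E).
Qed.

(** The set [W] stays fixed while [P] shrinks: it keeps the registers already written, on which the
    renaming has to remain injective. *)
Lemma runs_embed_rec X (P : program R J X) (W : seq nat) (mJ m : memory R)
    a b v (mJ' : memory R) t :
  straight_line P -> (forall r, r \in targets P -> r \in W) ->
  (forall r r', r \in W -> r' \in W -> rho r = rho r' -> r = r') -> (forall r, r \in W -> a <= rho r < b) ->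
  (forall j, holds inp a b m (g j) (inpJ j)) ->
  (forall r c, mJ.[? r]%fmap = Some c ->
     r \in W /\ m.[? rho r]%fmap = Some c) ->
  exec inpJ P mJ = Some (v, mJ', t) ->
  runs inp m (embed P) a b (size (targets P)) (fun w m' => w = v /\
    forall r c, mJ'.[? r]%fmap = Some c ->
      r \in W /\ m'.[? rho r]%fmap = Some c).
Proof.
move=> + + inj hW; elim: P m mJ t => [w|o r x y P IH|//] m mJ t /= hP hs hg hm.
  by case=> <- <- _; apply: runs_return.
have tr z c : value inpJ mJ z = Some c -> value inp m (translate z) = Some c.
  case: z => [j|i|c'] //=; first by case: (hg j) => _ -> .
  by case/hm.
case Ex: value => [cx|] //; case Ey: value => [cy|] //.
case Ea: arith => [c|] //; case E: exec => [[[w m1] t1]|] //= [hw hm1 _].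
have hr : r \in W by apply: hs; rewrite inE eqxx.
apply: (runs_op (tr _ _ Ex) (tr _ _ Ey) Ea (hW _ hr)).
rewrite hw hm1 in E; apply: (IH _ mJ.[r <- c]%fmap _ hP _ _ _ E).
- by move=> i hi; apply: hs; rewrite inE hi orbT.
- move=> j; apply: (holds_outside (leqnn a) (leqnn b)) (hg j) => i hi.
  by rewrite fnd_set; case: eqP => // E'; have := hW _ hr; lia.
- move=> i c'; rewrite !fnd_set; case: eqP => [->[<-]|ne].
    by rewrite eqxx.
  move=> /hm[hi ->]; split=> //; case: eqP => // E'.
  by case: ne; apply: inj.
Qed.

End Embedding.

Section Subroutine.
Variables (R : realType) (I J : Type) (inp : I -> R) (inpJ : J -> R).
Variables (g : J -> operand R I).

(** Registers are renumbered by first occurrence, which packs arbitrary register numbers into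
    consecutive ones; time thereby bounds space. *)
Definition relocate X a (P : program R J X) (r : nat) :=
  a + index r (targets P).

Lemma runs_embed X (P : program R J X) (m : memory R) a v (mJ : memory R) t :
  straight_line P ->
  (forall j, holds inp a (a + size (targets P)) m (g j) (inpJ j)) ->
  exec inpJ P [fmap]%fmap = Some (v, mJ, t) ->
  runs inp m (embed g (relocate a P) P) a (a + size (targets P))
    (size (targets P)) (fun w m' => w = v /\
    forall x c a' b', (forall j, avoids a' b' (g j)) ->
      (b' <= a) || (a + size (targets P) <= a') ->
      value inpJ mJ x = Some c ->
      holds inp a' b' m' (translate g (relocate a P) x) c).
Proof.
move=> hP hg hE.
apply: (runs_weaken (runs_embed_rec (W := targets P) hP _ _ _ hg _ hE)) => //.
- by move=> r s hr hs /addnI; apply: index_inj.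
- by move=> r hr; rewrite /relocate;
  have : index r (targets P) < size (targets P) by [rewrite index_mem]; lia.
- by move=> r c; rewrite fnd_fmap0.
- move=> w m' ho [-> h]; split=> // x c a' b' hav hab; case: x => [j|r|d] //=.
    move=> [<-]; split=> //.
    by have [] := holds_outside (leqnn _) (leqnn _) ho (hg j).
  move=> /h[hr hv]; apply: holds_reg => //; rewrite /relocate.
  by have : index r (targets P) < size (targets P) by [rewrite index_mem]; lia.
Qed.

End Subroutine.

Local Open Scope ring_scope.

(** * The rank of matrix multiplication *)

Section TensorRank.
Variables (R : realType) (k : nat).
Notation M := 'M[R]_k.
Notation J := ('I_k * 'I_k + 'I_k * 'I_k)%type.

Definition entry_input (A B : M) (e : J) : R :=
  match e with inl ij => A ij.1 ij.2 | inr ij => B ij.1 ij.2 end.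

Definition pairing (U A : M) : R := \sum_i \sum_j U i j * A i j.

Lemma pairingN U A : pairing U (- A) = - pairing U A.
Proof.
rewrite /pairing -sumrN; apply: eq_bigr => i _; rewrite -sumrN.
by apply: eq_bigr => j _; rewrite mxE mulrN.
Qed.

Lemma pairingZDl (c d : R) U V A :
  pairing (c *: U + d *: V) A = c * pairing U A + d * pairing V A.
Proof.
rewrite /pairing !mulr_sumr -big_split; apply: eq_bigr => i _.
rewrite /= !mulr_sumr -big_split; apply: eq_bigr => j _ /=.
by rewrite !mxE; ring.
Qed.

Lemma pairing0 A : pairing 0 A = 0.
Proof. by rewrite /pairing !big1 // => i _; rewrite big1 // => j _; rewrite mxE mul0r. Qed.

Lemma pairing_delta i j A : pairing (delta_mx i j) A = A i j.
Proof.
rewrite /pairing (bigD1 i) //= (bigD1 j) //= mxE !eqxx mul1r.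
rewrite big1 ?addr0 => [|j' nj]; last by rewrite mxE eqxx (negPf nj) mul0r.
rewrite big1 ?addr0 // => i' ni; rewrite big1 // => j' _.
by rewrite mxE (negPf ni) mul0r.
Qed.

Definition product (L : seq (M * M)) (l : nat) (A B : M) : R :=
  pairing (nth (0, 0) L l).1 A * pairing (nth (0, 0) L l).2 B.

Definition in_span (L : seq (M * M)) (f : M -> M -> R) :=
  exists w : nat -> R, forall A B, f A B = \sum_(l < size L) w l * product L l A B.

(** One operation adds at most two products: the part of [(U A + V B) (U' A + V' B)] that is
    bilinear in [A] and [B] is [U A * V' B + U' A * V B]. *)
Lemma in_span_cons2 L f g x y (a b c : R) :
  in_span L f -> in_span L g ->
  in_span (x :: y :: L) (fun A B => a * f A B + b * g A B +
    c * (pairing x.1 A * pairing x.2 B + pairing y.1 A * pairing y.2 B)).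
Proof.
move=> [w hw] [w' hw'].
exists (fun l => if l is l'.+2 then a * w l' + b * w' l' else c) => A B.
rewrite [RHS]big_ord_recl [X in _ = _ + X]big_ord_recl (eq_bigr (fun l : 'I_(size L) =>
    a * (w l * product L l A B) + b * (w' l * product L l A B))); last first.
  by move=> l _; rewrite /product !lift0 /=; ring.
by rewrite big_split /= -!mulr_sumr -hw -hw' /product /=; ring.
Qed.

(** Along the line [s |-> (s A, s B)] the value [g] is a quotient of polynomials
    [P / Q] in [s], expanding as [a + (<U, A> + <V, B>) s + q A B s^2] up to
    higher order; the part of [q] that is bilinear in [A] and [B] is spanned by
    the products in [L]. *)
Definition jet L (g : M -> M -> R -> R) :=
  exists a U V (q : M -> M -> R),
    in_span L (fun A B => (q A B - q A (- B)) / 2) /\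
    forall A B, exists P Q : {poly R},
    [/\ Q`_0 != 0, forall s, P.[s] = g A B s * Q.[s],
        P`_0 = a * Q`_0,
        P`_1 = a * Q`_1 + (pairing U A + pairing V B) * Q`_0
      & P`_2 = a * Q`_2 + (pairing U A + pairing V B) * Q`_1 + q A B * Q`_0].

Lemma coefM_le2 (P Q : {poly R}) :
  [/\ (P * Q)`_0 = P`_0 * Q`_0, (P * Q)`_1 = P`_0 * Q`_1 + P`_1 * Q`_0
    & (P * Q)`_2 = P`_0 * Q`_2 + P`_1 * Q`_1 + P`_2 * Q`_0].
Proof. by split; rewrite coefM !big_ord_recr big_ord0 /= add0r. Qed.

Lemma in_span_eq L f g : (forall A B, f A B = g A B) -> in_span L f -> in_span L g.
Proof. by move=> e [w h]; exists w => A B; rewrite -e. Qed.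

Lemma in_span0 L : in_span L (fun _ _ => 0).
Proof. by exists (fun=> 0) => A B; rewrite big1 // => i _; rewrite mul0r. Qed.

Lemma jet_linear L a U V (g : M -> M -> R -> R) :
  (forall A B s, g A B s = a + (pairing U A + pairing V B) * s) -> jet L g.
Proof.
move=> hg; exists a, U, V, (fun _ _ => 0); split.
  by apply: in_span_eq (in_span0 L) => A B; rewrite subrr mul0r.
move=> A B; exists (a%:P + (pairing U A + pairing V B) *: 'X), 1.
split.
- by rewrite coef1 oner_eq0.
- by move=> s; rewrite !hornerE hg.
- by rewrite !coefE /=; ring.
- by rewrite !coefE /=; ring.
- by rewrite !coefE /=; ring.
Qed.

Lemma jet_arith L o x y z :
  jet L x -> jet L y ->
  (forall A B s, arith o (x A B s) (y A B s) = Some (z A B s)) ->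
  exists p1 p2, jet (p1 :: p2 :: L) z.
Proof.
move=> [a [U [V [q [hq h]]]]] [a' [U' [V' [q' [hq' h']]]]].
case: o => hz.
- exists (0, 0), (0, 0), (a + a'), (1 *: U + 1 *: U'), (1 *: V + 1 *: V'),
    (fun A B => q A B + q' A B); split.
    by apply: in_span_eq (in_span_cons2 (0, 0) (0, 0) 1 1 0 hq hq') => A B /=; field.
  move=> A B; have [P [Q [Q0 PQ P0 P1 P2]]] := h A B.
  have [P' [Q' [Q0' PQ' P0' P1' P2']]] := h' A B.
  have [e1 e2 e3] := coefM_le2 Q Q'.
  have [f1 f2 f3] := coefM_le2 P Q'; have [g1 g2 g3] := coefM_le2 P' Q.
  exists (P * Q' + P' * Q), (Q * Q'); split.
  + by rewrite e1 mulf_neq0.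
  + by move=> s; rewrite !(hornerD, hornerN, hornerM) PQ PQ'; case: (hz A B s) => <-; ring.
  + by rewrite coefD e1 f1 g1 P0 P0'; ring.
  + by rewrite coefD e1 e2 f2 g2 P0 P0' P1 P1' !pairingZDl; ring.
  + by rewrite coefD e1 e2 e3 f3 g3 P0 P0' P1 P1' P2 P2' !pairingZDl; ring.
- exists (0, 0), (0, 0), (a - a'), (1 *: U + (-1) *: U'), (1 *: V + (-1) *: V'),
    (fun A B => q A B - q' A B); split.
    by apply: in_span_eq (in_span_cons2 (0, 0) (0, 0) 1 (-1) 0 hq hq') => A B /=; field.
  move=> A B; have [P [Q [Q0 PQ P0 P1 P2]]] := h A B.
  have [P' [Q' [Q0' PQ' P0' P1' P2']]] := h' A B.
  have [e1 e2 e3] := coefM_le2 Q Q'.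
  have [f1 f2 f3] := coefM_le2 P Q'; have [g1 g2 g3] := coefM_le2 P' Q.
  exists (P * Q' - P' * Q), (Q * Q'); split.
  + by rewrite e1 mulf_neq0.
  + by move=> s; rewrite !(hornerD, hornerN, hornerM) PQ PQ'; case: (hz A B s) => <-; ring.
  + by rewrite coefB e1 f1 g1 P0 P0'; ring.
  + by rewrite coefB e1 e2 f2 g2 P0 P0' P1 P1' !pairingZDl; ring.
  + by rewrite coefB e1 e2 e3 f3 g3 P0 P0' P1 P1' P2 P2' !pairingZDl; ring.
- exists (U, V'), (U', V), (a * a'), (a' *: U + a *: U'), (a' *: V + a *: V'),
    (fun A B => a' * q A B + a * q' A B +
      (pairing U A + pairing V B) * (pairing U' A + pairing V' B)); split.
    apply: in_span_eq (in_span_cons2 (U, V') (U', V) a' a 1 hq hq') => A B /=.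
    by rewrite !pairingN; field.
  move=> A B; have [P [Q [Q0 PQ P0 P1 P2]]] := h A B.
  have [P' [Q' [Q0' PQ' P0' P1' P2']]] := h' A B.
  have [e1 e2 e3] := coefM_le2 Q Q'; have [f1 f2 f3] := coefM_le2 P P'.
  exists (P * P'), (Q * Q'); split.
  + by rewrite e1 mulf_neq0.
  + by move=> s; rewrite !(hornerD, hornerN, hornerM) PQ PQ'; case: (hz A B s) => <-; ring.
  + by rewrite e1 f1 P0 P0'; ring.
  + by rewrite e1 e2 f2 P0 P0' P1 P1' !pairingZDl; ring.
  + by rewrite e1 e2 e3 f3 P0 P0' P1 P1' P2 P2' !pairingZDl; ring.
- have hz' A B s : y A B s != 0 /\ z A B s = x A B s / y A B s.
    by have := hz A B s; rewrite /=; case: eqP => // _ [<-].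
  (* The division is also carried out at [A = B = 0], [s = 0], where the divisor equals its constant
     term. *)
  have a0' : a' != 0.
    have [P' [Q' [Q0' PQ' P0' _ _]]] := h' 0 0.
    have := PQ' 0; rewrite !horner_coef0 P0' => /(mulIf Q0') ->.
    by case: (hz' 0 0 0).
  (* Coefficients of the quotient [z], found by comparing both sides of [x = z * y]: the linear part
     is [(l - c l') / a'] and the quadratic part is [(q - c q' - l2 l') / a'], where [l2] is the new
     linear part. *)
  pose c := a / a'.
  pose U2 := a'^-1 *: U + (- c / a') *: U'; pose V2 := a'^-1 *: V + (- c / a') *: V'.
  exists (U2, V'), (U', V2), c, U2, V2,
    (fun A B => a'^-1 * q A B + (- c / a') * q' A B +
      - a'^-1 * ((pairing U2 A + pairing V2 B) * (pairing U' A + pairing V' B))).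
  split.
    apply: in_span_eq (in_span_cons2 (U2, V') (U', V2) a'^-1 (- c / a') (- a'^-1)
      hq hq') => A B /=.
    by rewrite !pairingN; field.
  move=> A B; have [P [Q [Q0 PQ P0 P1 P2]]] := h A B.
  have [P' [Q' [Q0' PQ' P0' P1' P2']]] := h' A B.
  have [e1 e2 e3] := coefM_le2 P Q'; have [f1 f2 f3] := coefM_le2 Q P'.
  exists (P * Q'), (Q * P'); split.
  + by rewrite f1 P0' !mulf_neq0.
  + move=> s; have [y0 ->] := hz' A B s; rewrite !(hornerD, hornerN, hornerM) PQ PQ'.
    by field.
  + by rewrite e1 f1 P0 P0' /c; field.
  + by rewrite e2 f1 f2 P0 P0' P1 P1' !pairingZDl /c; field.
  + by rewrite e3 f1 f2 f3 P0 P0' P1 P1' P2 P2' !pairingZDl /c; field.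
Qed.

Lemma jet_cons2 L g p1 p2 : jet L g -> jet (p1 :: p2 :: L) g.
Proof.
move=> [a [U [V [q [hq h]]]]]; exists a, U, V, q; split=> //.
apply: in_span_eq (in_span_cons2 p1 p2 1 0 0 hq (in_span0 L)) => A B /=.
by ring.
Qed.

Lemma poly_eq0 (P : {poly R}) : (forall s, P.[s] = 0) -> P = 0.
Proof.
move=> h; apply/eqP/negPn/negP => P0.
have hr : all (root P) [seq i%:R | i <- iota 0 (size P)].
  by apply/allP => x _; rewrite /root h.
have hu : uniq [seq i%:R : R | i <- iota 0 (size P)].
  by rewrite map_inj_uniq ?iota_uniq // => i j /eqP; rewrite eqr_nat => /eqP.
by have := max_poly_roots P0 hr hu; rewrite size_map size_iota ltnn.
Qed.

(** The value [s^2 f] is its own expansion, so comparing coefficients forces [a = 0], a vanishing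
    linear part and [q = f]. As [f] is odd in [B], it equals its bilinear part. *)
Lemma jet_quadratic L g (f : M -> M -> R) :
  jet L g -> (forall A B s, g A B s = s ^+ 2 * f A B) ->
  (forall A B, f A (- B) = - f A B) -> in_span L f.
Proof.
move=> [a [U [V [q [hq h]]]]] hg hf.
suff e A B : q A B = f A B.
  by apply: in_span_eq hq => A B; rewrite !e hf; field.
have [P [Q [Q0 PQ P0 P1 P2]]] := h A B.
have E : P = 'X^2 * (f A B *: Q).
  apply/subr0_eq/poly_eq0 => s.
  by rewrite !(hornerD, hornerN, hornerM, hornerX, hornerZ) PQ hg; ring.
move: P0 P1 P2; rewrite E !coefXnM !coefZ /= => P0 P1 P2.
have a0 : a = 0 by apply: (mulIf Q0); rewrite -P0 mul0r.
have l0 : pairing U A + pairing V B = 0.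
  by apply: (mulIf Q0); move: P1; rewrite a0 !mul0r add0r => <-.
by apply: (mulIf Q0); rewrite P2 a0 l0; ring.
Qed.

(** Memories for all inputs are followed at once. Without sign tests, whether a register has been
    written is the same for every input. *)
Definition jet_memory L (mem : M -> M -> R -> memory R) := forall r,
  (forall A B s, (mem A B s).[? r]%fmap = None) \/
  exists2 g, jet L g & forall A B s, (mem A B s).[? r]%fmap = Some (g A B s).

Lemma jet_value L mem (x : operand R J) :
  jet_memory L mem ->
  (forall A B s, value (entry_input (s *: A) (s *: B)) (mem A B s) x <> None) ->
  exists2 g, jet L g & forall A B s,
    value (entry_input (s *: A) (s *: B)) (mem A B s) x = Some (g A B s).
Proof.
move=> hm; case: x => [[[i j]|[i j]]|r|c] /= hx.
- exists (fun A _ s => s * A i j); last by move=> A B s; rewrite mxE.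
  apply: (@jet_linear L 0 (delta_mx i j) 0) => A B s.
  by rewrite pairing_delta pairing0; ring.
- exists (fun _ B s => s * B i j); last by move=> A B s; rewrite mxE.
  apply: (@jet_linear L 0 0 (delta_mx i j)) => A B s.
  by rewrite pairing_delta pairing0; ring.
- case: (hm r) => [hn|//].
  by case: (hx 0 0 0).
- exists (fun _ _ _ => c) => //.
  apply: (@jet_linear L c 0 0) => A B s.
  by rewrite !pairing0; ring.
Qed.

Lemma exec_jet X (P : program R J X) L mem :
  straight_line P -> jet_memory L mem ->
  (forall A B s, exec (entry_input (s *: A) (s *: B)) P (mem A B s) <> None) ->
  exists out mem' L',
    [/\ (size L' <= size L + 2 * size (targets P))%N, jet_memory L' mem'
      & forall A B s, exists t,
        exec (entry_input (s *: A) (s *: B)) P (mem A B s) =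
          Some (out, mem' A B s, t)].
Proof.
elim: P L mem => [v|o r x y P IH|//] L mem /= hP hm hE.
  by exists v, mem, L; split; [rewrite muln0 addn0| |move=> A B s; exists 0%N].
have [gx jx ex] : exists2 g, jet L g & forall A B s,
    value (entry_input (s *: A) (s *: B)) (mem A B s) x = Some (g A B s).
  by apply: jet_value => // A B s e; apply: (hE A B s); rewrite e.
have [gy jy ey] : exists2 g, jet L g & forall A B s,
    value (entry_input (s *: A) (s *: B)) (mem A B s) y = Some (g A B s).
  apply: jet_value => // A B s e; apply: (hE A B s); rewrite e.
  by case: value.
(* The default 0 is never taken: by [hE] the operation succeeds on every input. *)
have [gz ez] : exists gz, forall A B s,
    arith o (gx A B s) (gy A B s) = Some (gz A B s).
  exists (fun A B s => odflt 0 (arith o (gx A B s) (gy A B s))) => A B s.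
  by have := hE A B s; rewrite ex ey; case: arith.
have [p1 [p2 jz]] := jet_arith jx jy ez.
have hm' : jet_memory (p1 :: p2 :: L) (fun A B s => (mem A B s).[r <- gz A B s]%fmap).
  move=> i; case: (eqVneq i r) => [->|ne].
    by right; exists gz => // A B s; rewrite fnd_set eqxx.
  case: (hm i) => [h|[g jg h]]; [left|right].
    by move=> A B s; rewrite fnd_set (negPf ne).
  by exists g; [apply: jet_cons2|move=> A B s; rewrite fnd_set (negPf ne)].
have [A B s e|out [mem' [L' [hs hj ho]]]] := IH _ _ hP hm'.
  by apply: (hE A B s); rewrite ex ey ez e.
exists out, mem', L'; split=> //; first by move: hs => /=; lia.
move=> A B s; have [t e] := ho A B s; exists t.+1.
by rewrite ex ey ez e.
Qed.

Definition multiplies (P : program R J ('I_k -> 'I_k -> operand R J)) :=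
  straight_line P /\
  forall A B : M, exists out m t,
    exec (entry_input A B) P [fmap]%fmap = Some (out, m, t) /\
    forall i j, value (entry_input A B) m (out i j) = Some ((A *m B) i j).

(** The classical bound of tensor rank by twice the arithmetic complexity, by elimination of
    divisions. The products in [L] are common to all entries; only the weights depend on [i] and
    [j]. *)
Lemma multiplies_rank P : multiplies P ->
  exists r (U V : nat -> M) (W : 'I_k -> 'I_k -> nat -> R),
    (r <= 2 * size (targets P))%N /\
    forall A B i j, (A *m B) i j =
      \sum_(l < r) W i j l * (pairing (U l) A * pairing (V l) B).
Proof.
move=> [hP hm].
have [|A B s|out [mem [L [hs hj ho]]]] :=
    @exec_jet _ P [::] (fun _ _ _ => [fmap]%fmap) hP.
- by move=> r; left=> A B s; rewrite fnd_fmap0.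
- by have [o [m [t [-> _]]]] := hm (s *: A) (s *: B).
(* The matrix product is homogeneous of degree 2, so on [(s A, s B)] each output is exactly [s^2]
   times an entry of [A B]. *)
have hv A B s i j : value (entry_input (s *: A) (s *: B)) (mem A B s) (out i j) =
    Some (s ^+ 2 * (A *m B) i j).
  have [o [m [t [e1 e2]]]] := hm (s *: A) (s *: B); have [t' e3] := ho A B s.
  move: e3; rewrite e1 => -[<- <- _]; rewrite e2; congr Some.
  by rewrite -scalemxAl -scalemxAr scalerA mxE expr2.
have /choice[W hW] i : exists W : 'I_k -> nat -> R, forall j A B,
    (A *m B) i j = \sum_(l < size L) W j l * product L l A B.
  have /choice[w hw] j : in_span L (fun A B => (A *m B) i j).
    have [|g jg hg] := @jet_value L mem (out i j) hj.
      by move=> A B s; rewrite hv.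
    apply: (jet_quadratic jg) => [A B s|A B]; last by rewrite mulmxN mxE.
    by have := hg A B s; rewrite hv => -[].
  by exists w.
by exists (size L), (fun l => (nth (0, 0) L l).1), (fun l => (nth (0, 0) L l).2), W.
Qed.

End TensorRank.

(** * Block products *)

Local Open Scope nat_scope.

Lemma sum_nat_block (V : nmodType) (F : nat -> V) M m :
  (\sum_(i < (M * m)%N) F i = \sum_(K < M) \sum_(i < m) F (K * m + i)%N)%R.
Proof.
elim: M => [|M IH]; first by rewrite mul0n !big_ord0.
rewrite mulSnr big_split_ord /= IH big_ord_recr /=; congr (_ + _)%R.
Qed.

Lemma sum_nat_divmod (V : nmodType) (F : nat -> nat -> V) M m :
  (\sum_(i < (M * m)%N) F (i %/ m)%N (i %% m)%N =
   \sum_(K < M) \sum_(i < m) F K i)%R.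
Proof.
rewrite (sum_nat_block (fun i => F (i %/ m) (i %% m))).
apply: eq_bigr => K _; apply: eq_bigr => i _.
rewrite divnMDl ?modnMDl ?modn_small ?divn_small ?addn0 //.
by case: i => /= i; lia.
Qed.

Lemma index_lt n m i j : i < n -> j < m -> i * m + j < n * m.
Proof. by move=> hi hj; have : i.+1 * m <= n * m by [rewrite leq_mul2r hi orbT]; lia. Qed.

Lemma divn_index m i j : j < m -> (i * m + j) %/ m = i.
Proof. by move=> hj; rewrite divnMDl ?divn_small ?addn0 //; lia. Qed.

Lemma modn_index m i j : j < m -> (i * m + j) %% m = j.
Proof. by move=> hj; rewrite modnMDl modn_small. Qed.

Lemma div_lt n m i : i < n * m -> i %/ m < n.
Proof. by move=> hi; rewrite ltn_divLR //; case: m hi => //; rewrite muln0. Qed.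

Lemma mod_lt n m i : i < n * m -> i %% m < m.
Proof. by move=> hi; rewrite ltn_mod; case: m hi => //; rewrite muln0. Qed.

Section Blocks.
Variable R : realType.

Definition nat_entry k (U : 'M[R]_k) (i j : nat) : R :=
  match insub i, insub j with Some i', Some j' => U i' j' | _, _ => 0%R end.

Lemma nat_entry_ord k (U : 'M[R]_k) (i j : 'I_k) : nat_entry U i j = U i j.
Proof. by rewrite /nat_entry !valK. Qed.

Definition rank_decomposition k r (u v w : nat -> nat -> nat -> R) :=
  forall (a b : nat -> nat -> R) i j, i < k -> j < k ->
  (\sum_(x < k) a i x * b x j =
   \sum_(l < r) w l i j * ((\sum_(x < k) \sum_(y < k) u l x y * a x y) *
                           (\sum_(x < k) \sum_(y < k) v l x y * b x y)))%R.

Lemma multiplies_decomposition k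
    (P : program R _ ('I_k -> 'I_k -> operand R _)) : multiplies P ->
  exists r u v w, r <= 2 * size (targets P) /\ rank_decomposition k r u v w.
Proof.
move=> /multiplies_rank[r [U [V [W [hr h]]]]].
exists r, (fun l => nat_entry (U l)), (fun l => nat_entry (V l)),
  (fun l => nat_entry (\matrix_(i, j) W i j l)); split=> // a b i j hi hj.
have := h (\matrix_(x, y) a x y)%R (\matrix_(x, y) b x y)%R (Ordinal hi) (Ordinal hj).
rewrite mxE => e.
have -> : (\sum_(x < k) a i x * b x j = \sum_(x < k)
    (\matrix_(x, y) a x y)%R (Ordinal hi) x * (\matrix_(x, y) b x y)%R x (Ordinal hj))%R.
  by apply: eq_bigr => x _; rewrite !mxE.
rewrite e; apply: eq_bigr => l _.
rewrite -[i]/(nat_of_ord (Ordinal hi)) -[j]/(nat_of_ord (Ordinal hj)).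
rewrite nat_entry_ord mxE; congr (_ * (_ * _))%R.
  by apply: eq_bigr => x _; apply: eq_bigr => y _; rewrite nat_entry_ord mxE.
by apply: eq_bigr => x _; apply: eq_bigr => y _; rewrite nat_entry_ord mxE.
Qed.

Variable I : Type.
Notation mxop := (nat -> nat -> operand R I).

Definition mult_spec n T S (mult : nat -> mxop -> mxop -> program R I unit) :=
  forall inp mem s (A B : mxop) (a b : nat -> nat -> R),
  (forall i j, i < n -> j < n -> holds inp s (s + S) mem (A i j) (a i j)) ->
  (forall i j, i < n -> j < n -> holds inp s (s + S) mem (B i j) (b i j)) ->
  runs inp mem (mult s A B) s (s + S) T (fun _ mem' =>
    forall i j, i < n -> j < n ->
      mem'.[? s + (i * n + j)]%fmap = Some (\sum_(x < n) a i x * b x j)%R).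

Section BlockProduct.
Variables (N m r : nat) (u v w : nat -> nat -> nat -> R).
Hypothesis huvw : rank_decomposition N r u v w.
Variable P : program R ('I_m * 'I_m + 'I_m * 'I_m)
  ('I_m -> 'I_m -> operand R ('I_m * 'I_m + 'I_m * 'I_m)).
Hypothesis hP : multiplies P.
Hypotheses (N0 : 0 < N) (m0 : 0 < m).

Let n := N * m.

Definition black_box_input sU sV (e : 'I_m * 'I_m + 'I_m * 'I_m) : operand R I :=
  match e with
  | inl ij => Reg (sU + (ij.1 * m + ij.2))
  | inr ij => Reg (sV + (ij.1 * m + ij.2))
  end.

Definition block_combination sU (c : nat -> nat -> R) (A : mxop) :=
  sum_of_products sU (m * m) (N * N) (fun q _ => Const (c (q %/ N) (q %% N)))
    (fun q i => A (q %/ N * m + i %/ m) (q %% N * m + i %% m)).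

Definition nat_operand (f : 'I_m -> 'I_m -> operand R I) (i j : nat) : operand R I :=
  match insub i, insub j with Some i', Some j' => f i' j' | _, _ => Const 0%R end.

(** The [l]-th product of the decomposition: its two linear forms, evaluated on blocks, go to [sU]
    and [sV], the program [P] multiplies them, and the result is added with its weight to every
    block of the output. The same areas serve all [l]. *)
Definition block_step s (A B : mxop) (l : nat) : program R I unit :=
  let sU := s + n * n in
  let sV := sU + m * m in
  let sP := sV + m * m in
  let sT := sP + size (targets P) in
  let g := black_box_input sU sV in
  bind (block_combination sU (u l) A) (fun=>
  bind (block_combination sV (v l) B) (fun=>
  bind (embed g (relocate sP P) P) (fun out =>
  bind (fill (n * n) sT (fun=> Mul)
    (fun i => Const (w l (i %/ n %/ m) (i %% n %/ m)))
    (fun i => nat_operand (fun x y => translate g (relocate sP P) (out x y))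
       (i %/ n %% m) (i %% n %% m))) (fun=>
  fill (n * n) s (fun=> Add) (fun i => Reg (s + i)) (fun i => Reg (sT + i)))))).

Definition block_product s (A B : mxop) : program R I unit :=
  bind (fill (n * n) s (fun=> Add) (fun=> Const 0%R) (fun=> Const 0%R)) (fun=>
  loop r (block_step s A B)).

Definition block_space := 2 * (n * n) + 2 * (m * m) + size (targets P).

Definition block_time :=
  n * n + r * (2 * (m * m + N * N * (m * m + m * m)) + size (targets P) + 2 * (n * n)).

Lemma runs_block_combination inp mem sU a b (c : nat -> nat -> R) (A : mxop)
    (x : nat -> nat -> R) :
  a <= sU -> sU + m * m + m * m <= b ->
  (forall i j, i < n -> j < n -> holds inp a b mem (A i j) (x i j)) ->
  runs inp mem (block_combination sU c A) sU (sU + m * m + m * m)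
    (m * m + N * N * (m * m + m * m)) (fun _ mem' =>
     forall i j, i < m -> j < m -> mem'.[? sU + (i * m + j)]%fmap =
       Some (\sum_(X < N) \sum_(Y < N) c X Y * x (X * m + i)%N (Y * m + j)%N)%R).
Proof.
move=> ha hb hA.
apply: (runs_weaken (runs_sum_of_products (u := fun q _ => c (q %/ N) (q %% N))
  (v := fun q i => x (q %/ N * m + i %/ m) (q %% N * m + i %% m)) _)) => //.
  move=> q i hq hi; split; first exact: holds_const.
  apply: holds_sub (hA _ _ _ _) => //; apply: index_lt; rewrite ?ltn_mod //.
  - exact: div_lt hq.
  - exact: div_lt hi.
move=> _ mem' _ h i j hi hj; rewrite h; last exact: index_lt.
rewrite divn_index // modn_index //.
by rewrite (sum_nat_divmod (fun X Y => c X Y * x (X * m + i)%N (Y * m + j)%N)%R).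
Qed.

(** A bilinear identity for scalars extends to blocks: for each fixed [i], [z], [j] it applies to
    the scalars at these positions inside the blocks, and summing over [z] gives the products of
    blocks. *)
Lemma block_identity (a b : nat -> nat -> R) X i Y j :
  X < N -> Y < N ->
  (\sum_(l < r) w l X Y * (\sum_(z < m)
     (\sum_(Z < N) \sum_(Z' < N) u l Z Z' * a (Z * m + i)%N (Z' * m + z)%N) *
     (\sum_(Z < N) \sum_(Z' < N) v l Z Z' * b (Z * m + z)%N (Z' * m + j)%N)) =
   \sum_(x < n) a (X * m + i)%N x * b x (Y * m + j)%N)%R.
Proof.
move=> hX hY.
rewrite (sum_nat_block (fun x => a (X * m + i)%N x * b x (Y * m + j)%N)%R).
under eq_bigr => l _ do rewrite mulr_sumr.
rewrite exchange_big [RHS]exchange_big /=; apply: eq_bigr => z _.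
by rewrite (huvw (fun Z Z' => a (Z * m + i)%N (Z' * m + z)%N)
  (fun Z Z' => b (Z * m + z)%N (Z' * m + j)%N)).
Qed.

Lemma block_product_spec : mult_spec n block_time block_space block_product.
Proof.
move=> inp mem s A B a b hA hB.
(* The scratch registers of the second linear combination run past [sP]; they fit into the work area
   by this inequality. *)
have mn : m * m <= n * n by rewrite /n; nia.
pose F l idx : R := (w l (idx %/ n %/ m)%N (idx %% n %/ m)%N * (\sum_(z < m)
  (\sum_(Z < N) \sum_(Z' < N) u l Z Z' * a (Z * m + idx %/ n %% m)%N (Z' * m + z)%N) *
  (\sum_(Z < N) \sum_(Z' < N) v l Z Z' * b (Z * m + z)%N (Z' * m + idx %% n %% m)%N)))%R.
pose Inv l (mem' : memory R) := forall i, i < n * n ->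
  mem'.[? s + i]%fmap = Some (\sum_(l' < l) F l' i)%R.
apply: (@runs_weaken R I inp _ mem _ s (s + block_space) _ _ block_time _
    (fun _ => Inv r)) => //; last first.
  move=> _ mem' _ h i j hi hj; rewrite h; last exact: index_lt.
  congr Some; rewrite /F divn_index // modn_index //.
  rewrite block_identity; try exact: div_lt.
  by rewrite -!divn_eq.
rewrite /block_product /block_time.
apply: (runs_bind (Q2 := fun=> Inv r) (runs_fill (u := fun=> 0%R)
  (v := fun=> 0%R) (c := fun=> 0%R) _)) => //.
- by move=> i hi; split=> //=; rewrite addr0.
- rewrite /block_space; lia.
move=> _ mem0 ho0 h0; apply: runs_loop.
  by move=> i hi; rewrite big_ord0; apply: h0.
move=> l mem1 hl ho1 hI.
have hA1 i j : i < n -> j < n -> holds inp s (s + block_space) mem1 (A i j) (a i j).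
  move=> hi hj; apply: (holds_outside _ _ ho1) => //.
  apply: (holds_outside _ _ ho0) => //; first by rewrite /block_space; lia.
  exact: hA.
have hB1 i j : i < n -> j < n -> holds inp s (s + block_space) mem1 (B i j) (b i j).
  move=> hi hj; apply: (holds_outside _ _ ho1) => //.
  apply: (holds_outside _ _ ho0) => //; first by rewrite /block_space; lia.
  exact: hB.
rewrite /block_step; set sU := s + n * n; set sV := sU + m * m.
set sP := sV + m * m; set sT := sP + size (targets P).
have hsT : s + block_space = sT + n * n.
  by rewrite /block_space /sT /sP /sV /sU; lia.
have hsV : s + n * n <= sV by rewrite /sV /sU; lia.
have hsP : s + n * n <= sP by rewrite /sP; lia.
set tC := m * m + _.
apply: (runs_bind (T2 := tC + (size (targets P) + (n * n + n * n)))
  (runs_block_combination (u l) (a := s) (b := s + block_space) _ _ hA1)).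
- by rewrite /sU; lia.
- by rewrite hsT /sT /sP /sV; lia.
- by rewrite /sU; lia.
- by rewrite hsT /sT /sP /sV; lia.
2: lia.
move=> _ mem2 ho2 hU.
apply: (runs_bind (T2 := size (targets P) + (n * n + n * n))
  (runs_block_combination (sU := sV) (v l) (a := s) (b := s + block_space) (x := b) _ _ _)).
- by rewrite /sV /sU; lia.
- by rewrite hsT /sT /sP; lia.
- move=> i j hi hj; apply: (holds_outside _ _ ho2 (hB1 i j hi hj)).
    by rewrite /sU; lia.
  by rewrite hsT /sT /sP /sV; lia.
- by rewrite /sV /sU; lia.
- by rewrite hsT /sT /sP; lia.
2: lia.
move=> _ mem3 ho3 hV.
pose Ul := (\matrix_(i < m, z < m)
  \sum_(Z < N) \sum_(Z' < N) u l Z Z' * a (Z * m + i)%N (Z' * m + z)%N)%R.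
pose Vl := (\matrix_(z < m, j < m)
  \sum_(Z < N) \sum_(Z' < N) v l Z Z' * b (Z * m + z)%N (Z' * m + j)%N)%R.
have [hsl hm] := hP; have [out [memJ [t [hE hout]]]] := hm Ul Vl.
apply: (runs_bind (T2 := n * n + n * n)
  (@runs_embed R I _ inp (entry_input Ul Vl) (black_box_input sU sV) _ P mem3 sP
    _ _ _ hsl _ hE)).
- move=> e; have hlt (x y : 'I_m) : x * m + y < m * m by exact: index_lt.
  case: e => -[i j]; apply: holds_reg; rewrite /=.
  + by have := hlt i j; rewrite /sP /sV; lia.
  + rewrite ho3; last by have := hlt i j; rewrite /sV; lia.
    by rewrite hU // mxE.
  + by have := hlt i j; rewrite /sP; lia.
  + by rewrite hV // mxE.
- by rewrite /sP /sV /sU; lia.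
- by rewrite hsT /sT; lia.
2: lia.
move=> out' mem4 ho4 [-> hres].
pose p l idx : R := (\sum_(z < m)
  (\sum_(Z < N) \sum_(Z' < N) u l Z Z' * a (Z * m + idx %/ n %% m)%N (Z' * m + z)%N) *
  (\sum_(Z < N) \sum_(Z' < N) v l Z Z' * b (Z * m + z)%N (Z' * m + idx %% n %% m)%N))%R.
apply: (runs_bind (T2 := n * n)
  (runs_fill (u := fun i => w l (i %/ n %/ m) (i %% n %/ m)) (v := p l) (c := F l) _)).
- move=> i hi; split; [exact: holds_const| |by []].
  rewrite /nat_operand.
  have hx : i %/ n %% m < m by rewrite ltn_mod.
  have hy : i %% n %% m < m by rewrite ltn_mod.
  rewrite (insubT (fun x => x < m) hx) (insubT (fun x => x < m) hy).
  apply: (hres _ _ _ _ _ _ _) => //=.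
  + have hlt (x y : 'I_m) : x * m + y < m * m by exact: index_lt.
    by case=> -[x y] /=; have := hlt x y; rewrite /sT /sP /sV; lia.
  + by apply/orP; right; rewrite /sT.
  + by rewrite hout !mxE; congr Some; apply: eq_bigr => z _; rewrite !mxE.
- by rewrite /sT; lia.
- by rewrite hsT.
2: lia.
move=> _ mem5 ho5 h5.
apply: (runs_weaken (runs_fill (u := fun i => (\sum_(l' < l) F l' i)%R)
  (v := F l) (c := fun i => (\sum_(l' < l.+1) F l' i)%R) _)) => //; last first.
  by rewrite hsT; lia.
move=> i hi; split.
- apply: holds_reg; first lia.
  rewrite ho5; last by rewrite /sT; lia.
  rewrite ho4; last by lia.
  rewrite ho3; last by lia.
  by rewrite ho2 ?hI //; rewrite /sU; lia.
- by apply: holds_reg; [rewrite /sT; lia|rewrite h5].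
- by rewrite /= big_ord_recr.
Qed.

End BlockProduct.
End Blocks.

Local Open Scope ring_scope.

(** * A fast product in quadratic space *)

Section FastProduct.
Variables (R : realType) (omega : R).
Hypotheses (homega : 2 < omega) (hmul : matmul_exponent omega).

Notation W := (2 `^ omega : R).

Lemma pow2_omega b : (2 ^ b)%:R `^ omega = W ^+ b.
Proof.
by rewrite natrX -(@powR_mulrn R 2 b) // -powRrM mulrC powRrM powR_mulrn ?powR_ge0.
Qed.

Lemma four_lt_W : 4 < W.
Proof.
have <- : 2 `^ 2%:R = 4 :> R by rewrite powR_mulrn // expr2; lra.
by rewrite /powR !ifN ?pnatr_eq0 // ltr_expR ltr_pM2r // ln_gt0 // ltr1n.
Qed.

Lemma straight_line_multiplication : exists2 c : R, 0 <= c & forall b,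
  exists P : program R ('I_(2 ^ b) * 'I_(2 ^ b) + 'I_(2 ^ b) * 'I_(2 ^ b))
      ('I_(2 ^ b) -> 'I_(2 ^ b) -> operand R _),
    multiplies P /\ (size (targets P))%:R <= c * W ^+ b.
Proof.
have [c hc] := hmul; exists `|c| => // b.
have [|P [hP h]] := hc (2 ^ b)%N; first by rewrite expn_gt0.
exists P; split.
  split=> // A B; have [out [m [t [e ho _]]]] := h A B.
  by exists out, m, t.
(* The length of a straight-line program is its time on any input; the zero matrices serve. *)
have [out [m [t [e _ ht]]]] := h 0 0.
rewrite -(exec_time hP e) -pow2_omega; apply: le_trans ht _.
by rewrite ler_wpM2r ?powR_ge0 // ler_norm.
Qed.

(** The least [b] with [4 ^ k <= W ^ b], about [2 k / omega]; minimality loses at most a factor [W],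
    and [W > 4] gives [b <= k]. *)
Lemma balanced_exponent k :
  exists b, [/\ (b <= k)%N, 4 ^+ k <= W ^+ b & W ^+ b <= W * 4 ^+ k].
Proof.
have W4 := four_lt_W.
have hk : 4 ^+ k <= W ^+ k by rewrite lerXn2r ?nnegrE //; lra.
have [b hb hmin] := ex_minnP (ex_intro (fun b => 4 ^+ k <= W ^+ b) k hk).
exists b; split=> //; first exact: hmin.
case: b hb hmin => [|b] hb hmin.
  have : 1 <= 4 ^+ k :> R by rewrite exprn_ege1 //; lra.
  by rewrite expr0; nra.
rewrite exprS ler_pM2l; last lra.
rewrite leNgt; apply/negP => h.
by have := hmin b (ltW h); rewrite ltnn.
Qed.

(** One level of blocking makes the product both fast and compact: a
    decomposition of rank [O(2 ^ (a omega))] is applied to blocks of size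
    [2 ^ b], multiplied by the given program, with [k = a + b].  Taking
    [W ^ b] of the order of [4 ^ k], the space [O(W ^ b)] of that program is
    affordable and so is recomputing the linear forms for each product, in time
    [O(4 ^ k)]. *)
Lemma fast_compact_product : exists2 C : R, 0 <= C & forall (I : Type) k,
  exists T S (mult : nat -> _ -> _ -> program R I unit),
    [/\ mult_spec (2 ^ k) T S mult, (2 ^ k * 2 ^ k <= S)%N,
        T%:R <= C * W ^+ k & S%:R <= C * 4 ^+ k].
Proof.
have W4 := four_lt_W.
have [c c0 hc] := straight_line_multiplication.
(* Time: rank at most [2 c W^a] times [(8 + c) W^b] per product gives [16 c + 2 c^2]. Space: [c W]
   for the registers of the given program, and 4 for the square arrays. *)
exists (4 + 16 * c + 2 * c ^+ 2 + c * W) => [|I k]; first by nra.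
have [b [hbk hb1 hb2]] := balanced_exponent k.
have [a ek] : exists a, k = (a + b)%N by exists (k - b)%N; lia.
have [Pa [hPa ha]] := hc a; have [P [hP hb]] := hc b.
have [r [u [v [w [hr huvw]]]]] := multiplies_decomposition hPa.
have N0 : (0 < 2 ^ a)%N by rewrite expn_gt0.
have m0 : (0 < 2 ^ b)%N by rewrite expn_gt0.
exists (block_time (2 ^ a) r P), (block_space (2 ^ a) P), (@block_product _ I (2 ^ a) _ r u v w P).
have e4 (i : nat) : (2 ^ i)%:R * (2 ^ i)%:R = 4 ^+ i :> R.
  by rewrite -natrM -expnMn natrX.
have en : (2 ^ a * 2 ^ b = 2 ^ k)%N by rewrite ek expnD.
have h4b : 4 ^+ b <= 4 ^+ k :> R by rewrite ler_weXn2l // ler1n.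
have hk : 4 ^+ k = 4 ^+ a * 4 ^+ b :> R by rewrite ek exprD.
have Wk : W ^+ k = W ^+ a * W ^+ b by rewrite ek exprD.
have Wa : 1 <= W ^+ a by rewrite exprn_ege1 //; lra.
have b4 : 1 <= 4 ^+ b :> R by rewrite exprn_ege1 //; lra.
have hr' : r%:R <= 2 * c * W ^+ a.
  have : r%:R <= (2 * size (targets Pa))%:R :> R by rewrite ler_nat.
  by rewrite natrM; nra.
split.
- by rewrite -en; apply: block_product_spec.
- by rewrite /block_space /= en -!addnA leq_addr.
- rewrite /block_time; cbv zeta; rewrite en !(natrD, natrM).
  set t := (size _)%:R in hb *.
  set r' : R := r%:R in hr' *.
  have r0 : 0 <= r' by rewrite /r' ler0n.
  rewrite !e4.
  set wa := W ^+ a in Wa Wk hr' *. set wb := W ^+ b in hb hb1 hb2 Wk *.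
  set x := 4 ^+ k in hb1 hb2 hk h4b *.
  set y := 4 ^+ a in hk *. set z := 4 ^+ b in hk h4b b4 *.
  rewrite Wk.
  have h1 : 2 * (z + y * (z + z)) + t + 2 * x <= (8 + c) * wb by nra.
  have h2 : r' * (2 * (z + y * (z + z)) + t + 2 * x) <= 2 * c * wa * ((8 + c) * wb).
    apply: ler_pM => //; rewrite /t; have := ler0n R (size (targets P)); nra.
  have h3 : wb <= wa * wb by nra.
  have h4 : 0 <= c * W * (wa * wb) by rewrite !mulr_ge0 //; nra.
  by nra.
- rewrite /block_space; cbv zeta; rewrite en !(natrD, natrM) !e4.
  set x := 4 ^+ k in hb1 hb2 hk h4b *.
  have h : c * W ^+ b <= c * (W * x) by rewrite ler_wpM2l.
  by nra.
Qed.

End FastProduct.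

(** * Inversion by pivoting on halves of the rows *)

Section NatMatrices.
Variable R : realType.
Implicit Types (f g b x : nat -> nat -> R).

(** Entries are kept as functions of natural numbers, so that cutting into blocks is index
    arithmetic without casts between dimensions and agrees with register addresses. *)
Definition nat_mx m n f : 'M[R]_(m, n) := \matrix_(i < m, j < n) f i j.

Definition nat_mul n f g i j : R := \sum_(x < n) f i x * g x j.

Lemma nat_mxM m n p f g :
  nat_mx m n f *m nat_mx n p g = nat_mx m p (nat_mul n f g).
Proof.
apply/matrixP => i j; rewrite !mxE; apply: eq_bigr => x _.
by rewrite !mxE.
Qed.

Lemma nat_mx_ext m n f g :
  (forall i j, (i < m)%N -> (j < n)%N -> f i j = g i j) -> nat_mx m n f = nat_mx m n g.
Proof. by move=> h; apply/matrixP => i j; rewrite !mxE h. Qed.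

Lemma nat_mx_col m1 m2 n f :
  nat_mx (m1 + m2) n f = col_mx (nat_mx m1 n f) (nat_mx m2 n (fun i => f (m1 + i)%N)).
Proof.
apply/matrixP => i j; rewrite -[i]splitK.
by case: (fintype.split i) => i' /=; rewrite ?col_mxEu ?col_mxEd !mxE.
Qed.

Lemma nat_mx_block m1 m2 n1 n2 f :
  nat_mx (m1 + m2) (n1 + n2) f =
  block_mx (nat_mx m1 n1 f) (nat_mx m1 n2 (fun i j => f i (n1 + j)%N))
    (nat_mx m2 n1 (fun i => f (m1 + i)%N))
    (nat_mx m2 n2 (fun i j => f (m1 + i)%N (n1 + j)%N)).
Proof.
apply/matrixP => i j; rewrite -[i]splitK -[j]splitK.
by case: (fintype.split i) => i'; case: (fintype.split j) => j' /=;
  rewrite ?block_mxEul ?block_mxEur ?block_mxEdl ?block_mxEdr !mxE.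
Qed.

Definition right_invertible m p b :=
  exists X : 'M[R]_(p, m), nat_mx m p b *m X = 1%:M.

(** Here [x1] is meant to be the inverse of the columns [sigma] of the upper half
    of [b]. *)
Definition schur m b (sigma : nat -> nat) x1 i q : R :=
  b (m + i)%N q - nat_mul m (fun i k => b (m + i)%N (sigma k)) (nat_mul m x1 b) i q.

Definition join_columns m (s1 s2 : nat -> nat) k :=
  if (k < m)%N then s1 k else s2 (k - m)%N.

(** The Schur complement formula for the inverse, with blocks [X1 + E F], [- E], [- X2 F] and [X2],
    where [E = X1 B12 X2] and [F = B21 X1]. Each entry is written as one sum or difference, hence
    [0 -] and [+ 0], so that a single [fill] computes them all. *)
Definition block_inverse m x1 x2 e f i k : R :=
  if (i < m)%N then
    if (k < m)%N then x1 i k + nat_mul m e f i k else 0 - e i (k - m)%N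
  else
    if (k < m)%N then 0 - nat_mul m x2 f (i - m)%N k
    else x2 (i - m)%N (k - m)%N + 0.

Lemma right_invertible_up m p b :
  right_invertible (m + m) p b -> right_invertible m p b.
Proof.
move=> [X]; rewrite nat_mx_col -[X]hsubmxK mul_col_row scalar_mx_block.
by move=> /eq_block_mx[h _ _ _]; exists (lsubmx X).
Qed.

(** The right half of a right inverse is annihilated by the upper rows and inverted by the lower
    ones. Subtracting combinations of upper rows therefore leaves it a right inverse. *)
Lemma right_invertible_schur m p b sigma x1 :
  right_invertible (m + m) p b -> right_invertible m p (schur m b sigma x1).
Proof.
move=> [X]; rewrite nat_mx_col -[X]hsubmxK mul_col_row scalar_mx_block.
move=> /eq_block_mx[_ h1 _ h2]; exists (rsubmx X).
have -> : nat_mx m p (schur m b sigma x1) = nat_mx m p (fun i => b (m + i)%N) -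
    nat_mx m m (fun i k => b (m + i)%N (sigma k)) *m (nat_mx m m x1 *m nat_mx m p b).
  by rewrite !nat_mxM; apply/matrixP => i j; rewrite !mxE.
by rewrite mulmxBl h2 -!mulmxA h1 !mulmx0 subr0.
Qed.

(** Block LU factorization: the selected columns form [[1 0; B21 X1 1]] times [[B11 B12; 0 S]],
    where [S] is their Schur complement, so the determinants multiply. *)
Lemma block_inverseP m b x1 x2 (s1 s2 : nat -> nat) :
  nat_mx m m x1 *m nat_mx m m (fun i k => b i (s1 k)) = 1%:M ->
  nat_mx m m x2 *m nat_mx m m (fun i k => schur m b s1 x1 i (s2 k)) = 1%:M ->
  let e := nat_mul m (fun i k => nat_mul m x1 b i (s2 k)) x2 in
  let f := nat_mul m (fun i k => b (m + i)%N (s1 k)) x1 in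
  let bs i k := b i (join_columns m s1 s2 k) in
  nat_mx (m + m) (m + m) (block_inverse m x1 x2 e f) *m
    nat_mx (m + m) (m + m) bs = 1%:M /\
  \det (nat_mx (m + m) (m + m) bs) =
    \det (nat_mx m m (fun i k => b i (s1 k))) *
    \det (nat_mx m m (fun i k => schur m b s1 x1 i (s2 k))).
Proof.
move=> h1 h2 e f bs.
set X1 := nat_mx m m x1 in h1 *; set X2 := nat_mx m m x2 in h2 *.
set B11 := nat_mx m m (fun i k => b i (s1 k)) in h1 *.
set S := nat_mx m m (fun i k => schur m b s1 x1 i (s2 k)) in h2 *.
pose B12 := nat_mx m m (fun i k => b i (s2 k)).
pose B21 := nat_mx m m (fun i k => b (m + i)%N (s1 k)).
pose B22 := nat_mx m m (fun i k => b (m + i)%N (s2 k)).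
have hB : nat_mx (m + m) (m + m) bs = block_mx B11 B12 B21 B22.
  rewrite nat_mx_block; congr block_mx; apply: nat_mx_ext => i j hi hj;
    by rewrite /bs /join_columns ?hj // ltnNge leq_addr /= addKn.
have hS : B22 = S + B21 *m X1 *m B12.
  rewrite -mulmxA !nat_mxM; apply/matrixP => i j; rewrite !mxE /schur.
  by rewrite /nat_mul subrK.
have hE : nat_mx m m e = X1 *m B12 *m X2 by rewrite !nat_mxM.
have hF : nat_mx m m f = B21 *m X1 by rewrite !nat_mxM.
have hX : nat_mx (m + m) (m + m) (block_inverse m x1 x2 e f) =
    block_mx (X1 + X1 *m B12 *m X2 *m (B21 *m X1)) (- (X1 *m B12 *m X2))
      (- (X2 *m (B21 *m X1))) X2.
  rewrite -hE -hF !nat_mxM nat_mx_block; congr block_mx; apply/matrixP => i j;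
    rewrite !mxE /block_inverse ?ltn_ord ?(ltnNge (m + _)) ?leq_addr ?addKn //=;
    by rewrite ?sub0r ?addr0.
have h21 : B21 *m X1 *m B11 = B21 by rewrite -mulmxA h1 mulmx1.
split.
  rewrite hX hB mulmx_block scalar_mx_block; congr block_mx.
  - by rewrite mulmxDl h1 -!mulmxA (mulmxA B21) h21 mulNmx !mulmxA addrK.
  - rewrite hS mulmxDl mulNmx mulmxDr opprD -!mulmxA h2 mulmx1 addrACA subrr add0r.
    by rewrite !mulmxA subrr.
  - by rewrite mulNmx -mulmxA h21 addNr.
  - by rewrite hS mulNmx mulmxDr h2 -!mulmxA addrCA addNr addr0.
rewrite hB.
have -> : block_mx B11 B12 B21 B22 =
    block_mx 1%:M 0 (B21 *m X1) 1%:M *m block_mx B11 B12 0 S.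
  rewrite mulmx_block !mul1mx !mul0mx ?mulmx0 !addr0 h21; congr block_mx.
  by rewrite hS addrC.
by rewrite det_mulmx det_lblock det_ublock !det1 !mul1r.
Qed.

End NatMatrices.

Local Open Scope nat_scope.

(** * Recursive pivoting as a program *)

Section Inversion.
Variables (R : realType) (I : Type).
Notation mxop := (nat -> nat -> operand R I).

(** The last panel is completed with zero columns; it consists only of them when [n] divides [p]. *)
Definition panel_count n p := (p %/ n).+1.

(** Column [q] of a wide product is column [q %% n] of its panel [q %/ n]. *)
Definition panel_reg n s i q := s + (q %/ n * (n * n) + (i * n + q %% n)).

(** Panel [c] is computed in place, with work space after it, so a product may spill only into
    panels that are not yet written. *)
Definition wide_product (mult : nat -> mxop -> mxop -> program R I unit) n p s
    (A B : mxop) : program R I unit :=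
  loop (panel_count n p) (fun c => mult (s + c * (n * n)) A
    (fun i j => if c * n + j < p then B i (c * n + j) else Const 0%R)).

Lemma runs_wide_product n p T S mult inp mem s (A B : mxop) (a b : nat -> nat -> R) :
  mult_spec n T S mult ->
  (forall i j, i < n -> j < n ->
     holds inp s (s + panel_count n p * (n * n) + S) mem (A i j) (a i j)) ->
  (forall i j, i < n -> j < p ->
     holds inp s (s + panel_count n p * (n * n) + S) mem (B i j) (b i j)) ->
  runs inp mem (wide_product mult n p s A B)
    s (s + panel_count n p * (n * n) + S) (panel_count n p * T) (fun _ mem' =>
    forall i q, i < n -> q < p ->
      mem'.[? panel_reg n s i q]%fmap = Some (nat_mul n a b i q)).
Proof.
move=> hmult hA hB.
pose Inv c (mem' : memory R) := forall i q, i < n -> q < p -> q %/ n < c ->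
  mem'.[? panel_reg n s i q]%fmap = Some (nat_mul n a b i q).
apply: (@runs_weaken _ _ _ _ _ _ s (s + panel_count n p * (n * n) + S) _ _
  (panel_count n p * T) _ (fun=> Inv (panel_count n p))) => //; last first.
  move=> _ mem' _ h i q hi hq; apply: h => //.
  by rewrite ltnS leq_div2r // ltnW.
apply: runs_loop => // c mem1 hc ho hI.
have hcn : c * (n * n) + n * n <= panel_count n p * (n * n).
  by rewrite addnC -mulSn leq_mul2r hc orbT.
apply: (runs_weaken (hmult inp mem1 (s + c * (n * n)) _ _ a
  (fun i j => if c * n + j < p then b i (c * n + j) else 0%R) _ _)) => //.
- move=> i j hi hj.
  apply: (holds_sub (a := s) (b := s + panel_count n p * (n * n) + S)); [lia|lia|].
  exact: holds_outside (leqnn _) (leqnn _) ho (hA _ _ _ _).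
- move=> i j hi hj; case: ifP => hp; last exact: holds_const.
  apply: (holds_sub (a := s) (b := s + panel_count n p * (n * n) + S)); [lia|lia|].
  by apply: holds_outside (leqnn _) (leqnn _) ho (hB _ _ _ hp).
- lia.
- lia.
move=> _ mem2 ho2 h i q hi hq hqc.
have n0 : 0 < n by case: n hi {hmult hA hB Inv hI ho ho2 h hcn hc hqc}.
move: hqc; rewrite ltnS leq_eqVlt orbC => /orP[hlt|/eqP e].
  rewrite ho2 ?hI //; apply/orP; left; rewrite /panel_reg ltn_add2l.
  apply: leq_trans (_ : (q %/ n).+1 * (n * n) <= _); last by rewrite leq_mul2r hlt orbT.
  by rewrite mulSnr ltn_add2l index_lt // ltn_mod.
have hq' : q = c * n + q %% n by rewrite -e -divn_eq.
rewrite /panel_reg e addnA h ?ltn_mod //; congr Some.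
by apply: eq_bigr => x _; rewrite -hq' hq.
Qed.

(** The chosen columns [sigma] are returned as control information, not stored, so later operations
    can address registers through them at no cost. The memory then holds the inverse of these
    columns, followed by their determinant. *)
Definition pivot_spec m p T S (pivot : nat -> mxop -> program R I (nat -> nat)) :=
  forall inp mem s (B : mxop) b,
  right_invertible m p b ->
  (forall i q, i < m -> q < p -> holds inp s (s + S) mem (B i q) (b i q)) ->
  runs inp mem (pivot s B) s (s + S) T (fun sigma mem' =>
    (forall k, k < m -> sigma k < p) /\
    exists x : nat -> nat -> R,
    [/\ forall i k, i < m -> k < m -> mem'.[? s + (i * m + k)]%fmap = Some (x i k),
        (nat_mx m m x *m nat_mx m m (fun i k => b i (sigma k)) = 1%:M)%R
      & mem'.[? s + m * m]%fmap =
          Some (\det (nat_mx m m (fun i k => b i (sigma k))))]).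

Fixpoint search (x : nat -> operand R I) (qs : seq nat) : program R I nat :=
  if qs is q :: qs' then
    SignTest (x q) (fun z => if z == 0%R then search x qs' else Return R I q)
  else Return R I 0.

Lemma runs_search inp mem x (u : nat -> R) a b qs :
  (forall q, q \in qs -> value inp mem (x q) = Some (u q)) ->
  (exists2 q, q \in qs & u q != 0%R) ->
  runs inp mem (search x qs) a b (size qs) (fun q mem' =>
    [/\ mem' = mem, q \in qs & u q != 0%R]).
Proof.
elim: qs => [|q qs IH] hx; first by case.
move=> hex; rewrite /runs /= hx ?inE ?eqxx //.
have e := sgz_eq0 (u q).
case: (eqVneq (sgz (u q)) 0%R) => hz.
  have [q' hq' hu] := hex; rewrite hz eqxx in e; move/esym/eqP: e => e.
  have [|| v [m' [t [hE ht ho [hm hv hv']]]]] := IH.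
  - by move=> k hk; apply: hx; rewrite inE hk orbT.
  - exists q' => //; move: hq'; rewrite inE => /orP[/eqP E|//].
    by rewrite E e eqxx in hu.
  exists v, m', t.+1; rewrite hE; split=> //.
  by split=> //; rewrite inE hv orbT.
exists q, mem, 1; split=> //; split=> //; first by rewrite inE eqxx.
by rewrite -e.
Qed.

Definition pivot_row p s (B : mxop) : program R I (nat -> nat) :=
  bind (search (B 0) (iota 0 p)) (fun q =>
  bind (fill 2 s (fun i => if i is 0 then Div else Add)
    (fun i => if i is 0 then Const 1%R else B 0 q)
    (fun i => if i is 0 then B 0 q else Const 0%R)) (fun=>
  Return R I (fun=> q))).

Lemma pivot_row_spec p : pivot_spec 1 p (p + 2) 2 (pivot_row p).
Proof.
move=> inp mem s B b [X hX] hB.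
have hne : exists2 q, q \in iota 0 p & b 0 q != 0%R.
  apply: contrapT => hn; have /matrixP/(_ ord0 ord0) := hX.
  rewrite !mxE eqxx big1 => [/esym/eqP|q _]; first by rewrite oner_eq0.
  rewrite mxE; case: (eqVneq (b 0 q) 0%R) => [->|h]; first by rewrite mul0r.
  by case: hn; exists (nat_of_ord q) => //; rewrite mem_iota add0n /=.
have hv q : q \in iota 0 p -> value inp mem (B 0 q) = Some (b 0 q).
  by rewrite mem_iota add0n => hq; case: (hB 0 q isT hq).
have := runs_search s (s + 2) hv hne; rewrite size_iota => hs.
apply: (runs_bind (T2 := 2) hs) => //.
move=> q mem' _ [-> ]; rewrite mem_iota add0n => hq hb.
apply: (runs_bind (T1 := 2) (T2 := 0) (runs_fill
  (u := fun i => if i is 0 then 1%R else b 0 q)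
  (v := fun i => if i is 0 then b 0 q else 0%R)
  (c := fun i => if i is 0 then (b 0 q)^-1%R else b 0 q) _)) => //.
  have h : holds inp s (s + 2) mem (B 0 q) (b 0 q) by apply: hB.
  case=> [|[|//]] _; split=> //; try (apply: holds_sub h; lia).
  - by rewrite /= (negPf hb) mul1r.
  - by rewrite /= addr0.
move=> _ mem1 _ h1; apply: runs_return; split=> //.
have hdet : (\det (nat_mx 1 1 (fun i _ => b i q)) = b 0 q)%R by rewrite det_mx11 mxE.
exists (fun _ _ => (b 0 q)^-1%R); split.
- by move=> [|//] [|//] _ _; rewrite h1.
- apply/matrixP => i j; rewrite !ord1 !mxE big_ord_recl big_ord0 addr0 !mxE.
  by rewrite mulVf.
- by rewrite hdet; rewrite (h1 1).
Qed.

Section PivotStep.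
Variables (m p T S Tm Sm : nat).
Variable pivot : nat -> mxop -> program R I (nat -> nat).
Variable mult : nat -> mxop -> mxop -> program R I unit.
Hypothesis hpivot : pivot_spec m p T S pivot.
Hypothesis hmult : mult_spec m Tm Sm mult.
Hypotheses (hS : m * m < S) (hSm : m * m <= Sm).

Definition block_reg s i k : operand R I := Reg (s + (i * m + k)).

(** The areas hold: [s1] the inverse [X1] and its determinant; [s2] the product [X1] times the upper
    rows; [s3] the product [B21] times [s2]; [s4] the Schur complement of all columns; [s5] the
    inverse [X2] and its determinant; [s6] to [s9] the products [E], [F], [X2 F], [E F]. They are
    ordered by time of writing, so the work space of a call spills only into areas filled later. *)
Definition pivot_step s (B : mxop) : program R I (nat -> nat) :=
  let sq := m * m in
  let wide := panel_count m p * sq in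
  let s1 := s + ((m + m) * (m + m) + 1) in
  let s2 := s1 + sq + 1 in
  let s3 := s2 + wide in
  let s4 := s3 + wide in
  let s5 := s4 + m * p in
  let s6 := s5 + sq + 1 in
  let s7 := s6 + sq in
  let s8 := s7 + sq in
  let s9 := s8 + sq in
  bind (pivot s1 B) (fun sigma1 =>
  bind (wide_product mult m p s2 (block_reg s1) B) (fun=>
  bind (wide_product mult m p s3 (fun i k => B (m + i) (sigma1 k))
    (fun i q => Reg (panel_reg m s2 i q))) (fun=>
  bind (fill (m * p) s4 (fun=> Sub) (fun t => B (m + t %/ p) (t %% p))
    (fun t => Reg (panel_reg m s3 (t %/ p) (t %% p)))) (fun=>
  bind (pivot s5 (fun i q => Reg (s4 + (i * p + q)))) (fun sigma2 =>
  bind (mult s6 (fun i k => Reg (panel_reg m s2 i (sigma2 k))) (block_reg s5)) (fun=>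
  bind (mult s7 (fun i k => B (m + i) (sigma1 k)) (block_reg s1)) (fun=>
  bind (mult s8 (block_reg s5) (block_reg s7)) (fun=>
  bind (mult s9 (block_reg s6) (block_reg s7)) (fun=>
  bind (fill ((m + m) * (m + m)) s
    (fun t => if (t %/ (m + m) < m) == (t %% (m + m) < m) then Add else Sub)
    (fun t => let i := t %/ (m + m) in let k := t %% (m + m) in
       if i < m then (if k < m then block_reg s1 i k else Const 0%R)
       else (if k < m then Const 0%R else block_reg s5 (i - m) (k - m)))
    (fun t => let i := t %/ (m + m) in let k := t %% (m + m) in
       if i < m then (if k < m then block_reg s9 i k else block_reg s6 i (k - m))
       else (if k < m then block_reg s8 (i - m) k else Const 0%R))) (fun=>
  bind (fill 1 (s + (m + m) * (m + m)) (fun=> Mul) (fun=> Reg (s1 + sq))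
    (fun=> Reg (s5 + sq))) (fun=>
  Return R I (join_columns m sigma1 sigma2)))))))))))).

Definition pivot_step_space :=
  (m + m) * (m + m) + 1 + (m * m + 1) + 2 * (panel_count m p * (m * m)) + m * p +
  (m * m + 1) + 4 * (m * m) + S + Sm.

Definition pivot_step_time :=
  2 * T + 2 * (panel_count m p * Tm) + m * p + 4 * Tm + (m + m) * (m + m) + 1.

Lemma panel_reg_lt s i q : i < m -> q < p ->
  s <= panel_reg m s i q < s + panel_count m p * (m * m).
Proof.
move=> hi hq; rewrite /panel_reg leq_addr ltn_add2l /panel_count mulSnr /=.
have h : q %/ m * (m * m) <= p %/ m * (m * m).
  by rewrite leq_mul2r leq_div2r ?orbT // ltnW.
apply: leq_ltn_trans (leq_add h (leqnn _)) _.
by rewrite ltn_add2l index_lt // ltn_mod; case: m hi.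
Qed.

Lemma pivot_step_spec : pivot_spec (m + m) p pivot_step_time pivot_step_space pivot_step.
Proof.
move=> inp mem s B b hinv hB.
rewrite /pivot_step; cbv zeta.
set s1 := s + _; set s2 := s1 + _ + 1; set wide := panel_count m p * (m * m).
set s3 := s2 + wide; set s4 := s3 + wide.
set s5 := s4 + m * p; set s6 := s5 + _ + 1; set s7 := s6 + _.
set s8 := s7 + _; set s9 := s8 + _.
set E := s + pivot_step_space in hB *.
have hE : E = s9 + m * m + S + Sm.
  by rewrite /E /pivot_step_space /s9 /s8 /s7 /s6 /s5 /s4 /s3 /s2 /s1 -/wide; lia.
have e1 : s1 = s + (m + m) * (m + m) + 1 by rewrite /s1 addnA.
have e2 : s2 = s1 + m * m + 1 by [].
have e3 : s3 = s2 + wide by [].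
have e4 : s4 = s3 + wide by [].
have e5 : s5 = s4 + m * p by [].
have e6 : s6 = s5 + m * m + 1 by [].
have e7 : s7 = s6 + m * m by [].
have e8 : s8 = s7 + m * m by [].
have e9 : s9 = s8 + m * m by [].
(* The offsets are now known only through linear equations, from which [lia] gets the disjointness
   of the areas. *)
clearbody E s1 s2 s3 s4 s5 s6 s7 s8 s9.
have hbl i k : i < m -> k < m -> i * m + k < m * m by exact: index_lt.
have hBu i q : i < m -> q < p -> holds inp s E mem (B i q) (b i q).
  by move=> hi hq; apply: hB => //; lia.
have hBd i q : i < m -> q < p -> holds inp s E mem (B (m + i) q) (b (m + i) q).
  by move=> hi hq; apply: hB => //; lia.
have keepB mem' : outside s E mem mem' -> forall i q, i < m -> q < p ->
    holds inp s E mem' (B i q) (b i q) /\ holds inp s E mem' (B (m + i) q) (b (m + i) q).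
  move=> ho i q hi hq; split; apply: (holds_outside (leqnn s) (leqnn E) ho);
    [exact: hBu|exact: hBd].
have hpr t i q : i < m -> q < p -> t <= panel_reg m t i q < t + wide.
  exact: panel_reg_lt.
(* [t2] to [t9] bound the time that remains after the successive calls. *)
pose w := panel_count m p * Tm; pose q4 := (m + m) * (m + m).
pose t9 := q4 + 1; pose t8 := Tm + t9; pose t7 := Tm + t8; pose t6 := Tm + t7.
pose t5 := Tm + t6; pose t4 := T + t5; pose t3 := m * p + t4; pose t2 := w + t3.
have et : pivot_step_time = T + (w + t2).
  by rewrite /pivot_step_time /t2 /t3 /t4 /t5 /t6 /t7 /t8 /t9 /w /q4; lia.
rewrite {}et; have ew := erefl wide; rewrite {1}/wide in ew.
have eq4 := erefl q4; rewrite {1}/q4 in eq4; rewrite eq4 in e1 *.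
clearbody q4 wide.
apply: (runs_bind (T2 := w + t2)
  (hpivot (s := s1) (right_invertible_up hinv) _)); try lia.
  by move=> i q hi hq; apply: holds_sub (hBu i q hi hq); lia.
move=> sg1 m1 ho1 [hsg1 [x1 [hx1 hinv1]]].
set D1 := (\det _)%R => hdet1.
have o1 : outside s E mem m1 by apply: outside_sub ho1; lia.
have hw := @runs_wide_product m p Tm Sm mult inp.
rewrite ew in hw.
apply: (runs_bind (T2 := t2) (hw m1 s2 (block_reg s1) B x1 b hmult _ _)); try lia.
- by move=> i j hi hj; have hb := hbl i j hi hj; apply: holds_reg; [lia|exact: hx1].
- move=> i q hi hq; have [h _] := keepB _ o1 i q hi hq.
  by apply: holds_sub h; lia.
move=> _ m2 ho2 hy; set y := nat_mul m x1 b in hy.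
have o2 : outside s E mem m2 by apply: outside_trans o1 (outside_sub _ _ ho2); lia.
have {}hx1 i k : i < m -> k < m -> m2.[? s1 + (i * m + k)]%fmap = Some (x1 i k).
  by move=> hi hk; have hb := hbl i k hi hk; rewrite ho2 ?hx1 //; lia.
have {}hdet1 : m2.[? s1 + m * m]%fmap = Some D1
  by rewrite ho2 ?hdet1 //; lia.
pose b21 i k := b (m + i) (sg1 k).
apply: (runs_bind (T2 := t3) (hw m2 s3 (fun i k => B (m + i) (sg1 k))
  (fun i q => Reg (panel_reg m s2 i q)) b21 y hmult _ _)); try lia.
- move=> i j hi hj; have [_ h] := keepB _ o2 i _ hi (hsg1 j hj).
  by apply: holds_sub h; lia.
- by move=> i q hi hq; have hb := hpr s2 i q hi hq; apply: holds_reg; [lia|exact: hy].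
move=> _ m3 ho3 hz.
have o3 : outside s E mem m3 by apply: outside_trans o2 (outside_sub _ _ ho3); lia.
have {}hx1 i k : i < m -> k < m -> m3.[? s1 + (i * m + k)]%fmap = Some (x1 i k).
  by move=> hi hk; have hb := hbl i k hi hk; rewrite ho3 ?hx1 //; lia.
have {}hdet1 : m3.[? s1 + m * m]%fmap = Some D1
  by rewrite ho3 ?hdet1 //; lia.
have {}hy i q : i < m -> q < p -> m3.[? panel_reg m s2 i q]%fmap = Some (y i q).
  by move=> hi hq; have hb := hpr s2 i q hi hq; rewrite ho3 ?hy //; lia.
pose g := schur m b sg1 x1.
apply: (runs_bind (T2 := t4) (runs_fill (dst := s4)
  (u := fun t => b (m + t %/ p) (t %% p))
  (v := fun t => nat_mul m b21 y (t %/ p) (t %% p))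
  (c := fun t => g (t %/ p) (t %% p)) _)); try lia.
  move=> t ht; have hi := div_lt ht; have hq := mod_lt ht.
  have [_ h] := keepB _ o3 _ _ hi hq.
  split=> //; first by apply: holds_sub h; lia.
  by apply: holds_reg; [have hb := hpr s3 _ _ hi hq; lia|exact: hz].
move=> _ m4 ho4 hg'.
have hg i q : i < m -> q < p -> m4.[? s4 + (i * p + q)]%fmap = Some (g i q).
  by move=> hi hq; rewrite hg' ?index_lt // divn_index ?modn_index.
have o4 : outside s E mem m4 by apply: outside_trans o3 (outside_sub _ _ ho4); lia.
have {}hx1 i k : i < m -> k < m -> m4.[? s1 + (i * m + k)]%fmap = Some (x1 i k).
  by move=> hi hk; have hb := hbl i k hi hk; rewrite ho4 ?hx1 //; lia.
have {}hdet1 : m4.[? s1 + m * m]%fmap = Some D1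
  by rewrite ho4 ?hdet1 //; lia.
have {}hy i q : i < m -> q < p -> m4.[? panel_reg m s2 i q]%fmap = Some (y i q).
  by move=> hi hq; have hb := hpr s2 i q hi hq; rewrite ho4 ?hy //; lia.
apply: (runs_bind (T2 := t5) (hpivot (s := s5) (b := g)
  (right_invertible_schur sg1 x1 hinv) _)); try lia.
  move=> i q hi hq; apply: holds_reg; last exact: hg.
  by have := index_lt hi hq; lia.
move=> sg2 m5 ho5 [hsg2 [x2 [hx2 hinv2]]].
set D2 := (\det _)%R => hdet2.
have o5 : outside s E mem m5 by apply: outside_trans o4 (outside_sub _ _ ho5); lia.
have {}hx1 i k : i < m -> k < m -> m5.[? s1 + (i * m + k)]%fmap = Some (x1 i k).
  by move=> hi hk; have hb := hbl i k hi hk; rewrite ho5 ?hx1 //; lia.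
have {}hdet1 : m5.[? s1 + m * m]%fmap = Some D1
  by rewrite ho5 ?hdet1 //; lia.
have {}hy i q : i < m -> q < p -> m5.[? panel_reg m s2 i q]%fmap = Some (y i q).
  by move=> hi hq; have hb := hpr s2 i q hi hq; rewrite ho5 ?hy //; lia.
apply: (runs_bind (T2 := t6) (hmult (s := s6) (a := fun i k => y i (sg2 k)) (b := x2) _ _));
  try lia.
- move=> i k hi hk; have hb := hpr s2 i _ hi (hsg2 k hk).
  by apply: holds_reg; [lia|apply: hy => //; apply: hsg2].
- by move=> i k hi hk; have hb := hbl i k hi hk; apply: holds_reg; [lia|exact: hx2].
move=> _ m6 ho6 he; set e := nat_mul m (fun i k => y i (sg2 k)) x2 in he.
have o6 : outside s E mem m6 by apply: outside_trans o5 (outside_sub _ _ ho6); lia.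
have {}hx1 i k : i < m -> k < m -> m6.[? s1 + (i * m + k)]%fmap = Some (x1 i k).
  by move=> hi hk; have hb := hbl i k hi hk; rewrite ho6 ?hx1 //; lia.
have {}hdet1 : m6.[? s1 + m * m]%fmap = Some D1
  by rewrite ho6 ?hdet1 //; lia.
have {}hx2 i k : i < m -> k < m -> m6.[? s5 + (i * m + k)]%fmap = Some (x2 i k).
  by move=> hi hk; have hb := hbl i k hi hk; rewrite ho6 ?hx2 //; lia.
have {}hdet2 : m6.[? s5 + m * m]%fmap = Some D2
  by rewrite ho6 ?hdet2 //; lia.
apply: (runs_bind (T2 := t7) (hmult (s := s7) (a := b21) (b := x1) _ _)); try lia.
- move=> i j hi hj; have [_ h] := keepB _ o6 i _ hi (hsg1 j hj).
  by apply: holds_sub h; lia.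
- by move=> i k hi hk; have hb := hbl i k hi hk; apply: holds_reg; [lia|exact: hx1].
move=> _ m7 ho7 hf; set f := nat_mul m b21 x1 in hf.
have {}hx1 i k : i < m -> k < m -> m7.[? s1 + (i * m + k)]%fmap = Some (x1 i k).
  by move=> hi hk; have hb := hbl i k hi hk; rewrite ho7 ?hx1 //; lia.
have {}hdet1 : m7.[? s1 + m * m]%fmap = Some D1
  by rewrite ho7 ?hdet1 //; lia.
have {}hx2 i k : i < m -> k < m -> m7.[? s5 + (i * m + k)]%fmap = Some (x2 i k).
  by move=> hi hk; have hb := hbl i k hi hk; rewrite ho7 ?hx2 //; lia.
have {}hdet2 : m7.[? s5 + m * m]%fmap = Some D2
  by rewrite ho7 ?hdet2 //; lia.
have {}he i k : i < m -> k < m -> m7.[? s6 + (i * m + k)]%fmap = Some (e i k).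
  by move=> hi hk; have hb := hbl i k hi hk; rewrite ho7 ?he //; lia.
apply: (runs_bind (T2 := t8) (hmult (s := s8) (a := x2) (b := f) _ _)); try lia.
- by move=> i k hi hk; have hb := hbl i k hi hk; apply: holds_reg; [lia|exact: hx2].
- by move=> i k hi hk; have hb := hbl i k hi hk; apply: holds_reg; [lia|exact: hf].
move=> _ m8 ho8 hh; set h := nat_mul m x2 f in hh.
have {}hx1 i k : i < m -> k < m -> m8.[? s1 + (i * m + k)]%fmap = Some (x1 i k).
  by move=> hi hk; have hb := hbl i k hi hk; rewrite ho8 ?hx1 //; lia.
have {}hdet1 : m8.[? s1 + m * m]%fmap = Some D1
  by rewrite ho8 ?hdet1 //; lia.
have {}hx2 i k : i < m -> k < m -> m8.[? s5 + (i * m + k)]%fmap = Some (x2 i k).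
  by move=> hi hk; have hb := hbl i k hi hk; rewrite ho8 ?hx2 //; lia.
have {}hdet2 : m8.[? s5 + m * m]%fmap = Some D2
  by rewrite ho8 ?hdet2 //; lia.
have {}he i k : i < m -> k < m -> m8.[? s6 + (i * m + k)]%fmap = Some (e i k).
  by move=> hi hk; have hb := hbl i k hi hk; rewrite ho8 ?he //; lia.
have {}hf i k : i < m -> k < m -> m8.[? s7 + (i * m + k)]%fmap = Some (f i k).
  by move=> hi hk; have hb := hbl i k hi hk; rewrite ho8 ?hf //; lia.
apply: (runs_bind (T2 := t9) (hmult (s := s9) (a := e) (b := f) _ _)); try lia.
- by move=> i k hi hk; have hb := hbl i k hi hk; apply: holds_reg; [lia|exact: he].
- by move=> i k hi hk; have hb := hbl i k hi hk; apply: holds_reg; [lia|exact: hf].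
move=> _ m9 ho9 hl; set l := nat_mul m e f in hl.
have {}hx1 i k : i < m -> k < m -> m9.[? s1 + (i * m + k)]%fmap = Some (x1 i k).
  by move=> hi hk; have hb := hbl i k hi hk; rewrite ho9 ?hx1 //; lia.
have {}hdet1 : m9.[? s1 + m * m]%fmap = Some D1
  by rewrite ho9 ?hdet1 //; lia.
have {}hx2 i k : i < m -> k < m -> m9.[? s5 + (i * m + k)]%fmap = Some (x2 i k).
  by move=> hi hk; have hb := hbl i k hi hk; rewrite ho9 ?hx2 //; lia.
have {}hdet2 : m9.[? s5 + m * m]%fmap = Some D2
  by rewrite ho9 ?hdet2 //; lia.
have {}he i k : i < m -> k < m -> m9.[? s6 + (i * m + k)]%fmap = Some (e i k).
  by move=> hi hk; have hb := hbl i k hi hk; rewrite ho9 ?he //; lia.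
have {}hh i k : i < m -> k < m -> m9.[? s8 + (i * m + k)]%fmap = Some (h i k).
  by move=> hi hk; have hb := hbl i k hi hk; rewrite ho9 ?hh //; lia.
apply: (runs_bind (T2 := 1) (runs_fill (dst := s)
  (u := fun t => let i := t %/ (m + m) in let k := t %% (m + m) in
     if i < m then (if k < m then x1 i k else 0%R)
     else (if k < m then 0%R else x2 (i - m) (k - m)))
  (v := fun t => let i := t %/ (m + m) in let k := t %% (m + m) in
     if i < m then (if k < m then l i k else e i (k - m))
     else (if k < m then h (i - m) k else 0%R))
  (c := fun t => block_inverse m x1 x2 e f (t %/ (m + m)) (t %% (m + m))) _)); try lia.
  move=> t; rewrite -eq4 => ht; have hi := div_lt ht; have hk := mod_lt ht.
  rewrite eq4 in ht; move: (t %/ _) (t %% _) hi hk => i k hi hk /=.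
  rewrite /block_inverse; case: (ltnP i m) => hi'; case: (ltnP k m) => hk' //=.
  - have hb := hbl i k hi' hk'.
    by split=> //; apply: holds_reg; rewrite ?hx1 ?hl //; lia.
  - have hk2 : k - m < m by lia.
    have hb := hbl i (k - m) hi' hk2.
    by split=> //; apply: holds_reg; rewrite ?he //; lia.
  - have hi2 : i - m < m by lia.
    have hb := hbl (i - m) k hi2 hk'.
    by split=> //; apply: holds_reg; rewrite ?hh //; lia.
  - have hi2 : i - m < m by lia.
    have hk2 : k - m < m by lia.
    move: (i - m) hi2 (k - m) hk2 => i2 hi2 k2 hk2; have hb := hbl i2 k2 hi2 hk2.
    by split=> //; apply: holds_reg; rewrite ?hx2 //; lia.
move=> _ m10 ho10 hX.
have [hinvb hdetb] := block_inverseP hinv1 hinv2.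
apply: (runs_bind (T2 := 0) (runs_fill (dst := s + q4)
  (u := fun=> D1) (v := fun=> D2) (c := fun=> (D1 * D2)%R) _)); try lia.
  move=> i hi; split=> //; apply: holds_reg; try lia.
  - by rewrite ho10 ?hdet1 //; lia.
  - by rewrite ho10 ?hdet2 //; lia.
move=> _ m11 ho11 hD; apply: runs_return; split.
  move=> k hk; rewrite /join_columns; case: (ltnP k m) => hk'; first exact: hsg1.
  by apply: hsg2; lia.
exists (block_inverse m x1 x2 e f); split=> //.
- move=> i k hi hk; have ht : i * (m + m) + k < q4 by rewrite -eq4 index_lt.
  by rewrite ho11 ?hX ?divn_index ?modn_index //; lia.
- by rewrite hdetb -[s + q4]addn0 hD.
Qed.

End PivotStep.
End Inversion.

Local Open Scope ring_scope.

(** * Cost of the recursion *)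

Section FastInversion.
Variables (R : realType) (omega : R).
Hypotheses (homega : 2 < omega) (hmul : matmul_exponent omega).

Notation W := (2 `^ omega : R).

(** Halving the number of rows halves the number of blocks but divides the cost
    of a block product by [W > 4], hence the ratio [W / 2 > 2] between the
    levels of the recursion. *)
Lemma fast_pivot : exists2 K : R, 0 <= K & forall (I : Type) n j, (j <= n)%N ->
  exists T S (pivot : nat -> _ -> program R I (nat -> nat)),
    [/\ pivot_spec (2 ^ j) (2 ^ n) T S pivot, (2 ^ j * 2 ^ j < S)%N,
        T%:R <= K * (2 ^+ n * (W / 2) ^+ j) & S%:R <= K * (2 ^+ j * 2 ^+ n)].
Proof.
have W4 := four_lt_W homega.
have [C C0 hC] := fast_compact_product homega hmul.
set V := W / 2; have V2 : 2 < V by rewrite /V; lra.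
(* One level costs twice the previous one plus [(8 C + 6) 2^n V^j], which [K V^j.+1] absorbs when
   [K (V - 2) >= 8 C + 6]. The space grows by at most [(18 + C) 2^j 2^n] per level. *)
pose K := (8 * C + 6) / (V - 2) + 18 + C.
have hK0 : 0 <= (8 * C + 6) / (V - 2) by rewrite divr_ge0 //; lra.
have hKV : 8 * C + 6 <= K * (V - 2).
  have -> : K * (V - 2) = 8 * C + 6 + (18 + C) * (V - 2).
    by rewrite /K; field; lra.
  nra.
have hK18 : 18 + C <= K by rewrite /K; lra.
clearbody K; clear hK0.
exists K => [|I n]; first lra.
elim=> [|j IH] hj.
  have n1 : 1 <= 2 ^+ n :> R by rewrite exprn_ege1 //; lra.
  exists (2 ^ n + 2)%N, 2%N, (@pivot_row _ _ (2 ^ n)); split=> //.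
  - exact: pivot_row_spec.
  - by rewrite natrD natrX expr0; nra.
  - by rewrite expr0; nra.
have [T [S [pivot [hpivot hmS hT hS]]]] := IH (ltnW hj).
have [Tm [Sm [mult [hmult hmm hTm hSm]]]] := hC I j.
exists (pivot_step_time (2 ^ j) (2 ^ n) T Tm), (pivot_step_space (2 ^ j) (2 ^ n) S Sm),
  (pivot_step (2 ^ j) (2 ^ n) pivot mult).
have e2 : (2 ^ j.+1 = 2 ^ j + 2 ^ j)%N by rewrite expnS mul2n addnn.
have hmp : (2 ^ j <= 2 ^ n)%N by rewrite leq_exp2l // ltnW.
have hnch : (panel_count (2 ^ j) (2 ^ n) * 2 ^ j <= 2 * 2 ^ n)%N.
  by rewrite /panel_count mulSnr mul2n -addnn leq_add // leq_divM.
have hmV : 2 ^+ j <= V ^+ j by rewrite lerXn2r ?nnegrE //; lra.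
have hWV : W ^+ j = 2 ^+ j * V ^+ j.
  by rewrite -exprMn /V; congr (_ ^+ _); field.
have h44 : 4 ^+ j = 2 ^+ j * 2 ^+ j :> R by rewrite -exprMn; congr (_ ^+ _); ring.
have m1 : 1 <= 2 ^+ j :> R by rewrite exprn_ege1 //; lra.
have hmpR : 2 ^+ j <= 2 ^+ n :> R by rewrite -!natrX ler_nat.
have hnchR : (panel_count (2 ^ j) (2 ^ n))%:R * 2 ^+ j <= 2 * 2 ^+ n :> R.
  by rewrite -!natrX -!natrM ler_nat.
have c0 : 0 <= (panel_count (2 ^ j) (2 ^ n))%:R :> R by rewrite ler0n.
split.
- by rewrite e2; apply: pivot_step_spec.
- by rewrite e2 /pivot_step_space -!addnA -[X in (X < _)%N]addn0 ltn_add2l.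
- rewrite /pivot_step_time !(natrD, natrM) !natrX exprS.
  set c : R := (panel_count _ _)%:R in hnchR c0 *.
  set m : R := 2 ^+ j in hmV hWV h44 m1 hmpR hnchR hS *.
  set p : R := 2 ^+ n in hmpR hnchR hT hS *.
  set v := V ^+ j in hmV hWV hT *.
  rewrite hWV in hTm.
  have pv : 0 <= p * v by nra.
  have h1 : c * Tm%:R <= 2 * C * (p * v).
    have : c * Tm%:R <= c * (C * (m * v)) by rewrite ler_wpM2l.
    have : c * m * (C * v) <= 2 * p * (C * v) by rewrite ler_wpM2r //; nra.
    by nra.
  have h2 : m * p <= p * v by nra.
  have h3 : Tm%:R <= C * (p * v).
    have : C * (m * v) <= C * (p * v) by rewrite ler_wpM2l //; nra.
    by lra.
  have h4 : (m + m) * (m + m) <= 4 * (p * v) by nra.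
  have h5 : 1 <= p * v by nra.
  have h6 : K * (V * (p * v)) = 2 * (K * (p * v)) + K * (V - 2) * (p * v) by ring.
  have h7 : (8 * C + 6) * (p * v) <= K * (V - 2) * (p * v) by rewrite ler_wpM2r.
  have -> : K * (p * (V * v)) = K * (V * (p * v)) by ring.
  by lra.
- rewrite /pivot_step_space !(natrD, natrM) !natrX exprS.
  set c : R := (panel_count _ _)%:R in hnchR c0 *.
  set m : R := 2 ^+ j in hmV hWV h44 m1 hmpR hnchR hS *.
  set p : R := 2 ^+ n in hmpR hnchR hT hS *.
  rewrite h44 in hSm.
  have h1 : c * (m * m) <= 2 * (m * p).
    have : c * m * m <= 2 * p * m by rewrite ler_wpM2r //; lra.
    by nra.
  have h2 : m * m <= m * p by nra.
  have h3 : 1 <= m * p by nra.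
  have h4 : C * (m * m) <= C * (m * p) by rewrite ler_wpM2l.
  have h5 : (18 + C) * (m * p) <= K * (m * p) by rewrite ler_wpM2r //; lra.
  have -> : K * (2 * m * p) = K * (m * p) + K * (m * p) by ring.
  by lra.
Qed.

End FastInversion.

(** * Orientation matrices *)

Section ColumnUpdate.
Variables (R : fieldType) (n : nat) (A A' N : 'M[R]_n) (j : 'I_n).
Hypothesis hN : N *m A = 1%:M.
Hypothesis hA' : forall r i, i != j -> A' r i = A r i.

Definition image_coord i := \sum_r N i r * A' r j.

(** Cramer's rule: the cofactors along column [j] are common to [A] and [A'], and the adjugate of
    [A] is [\det A *: N]. *)
Lemma det_column_update : \det A' = \det A * image_coord j.
Proof.
have hadj : \adj A = \det A *: N.
  by rewrite -[\adj A]mulmx1 -(mulmx1C hN) mulmxA mul_adj_mx mul_scalar_mx.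
rewrite (expand_det_col A' j) /image_coord mulr_sumr; apply: eq_bigr => r _.
have -> : cofactor A' r j = cofactor A r j.
  congr (_ * \det _); apply/matrixP => x y; rewrite !mxE hA' //.
  by rewrite eq_sym neq_lift.
have -> : cofactor A r j = \adj A j r by rewrite mxE.
by rewrite hadj mxE; ring.
Qed.

(** The matrix [N A'] is the identity except for column [j], which consists of the [image_coord i].
    Its inverse acts on [N] by dividing row [j] by the pivot and subtracting multiples of the result
    from the other rows. *)
Lemma inverse_column_update (N' : 'M[R]_n) : image_coord j != 0 ->
  (forall i r, N' i r = if i == j then N j r / image_coord j
     else N i r - image_coord i * (N j r / image_coord j)) ->
  N' *m A' = 1%:M.
Proof.
move=> yj hN'; apply/matrixP => i k; rewrite !mxE.
have hNA x : \sum_r N x r * A' r k = if k == j then image_coord x else (x == k)%:R.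
  case: eqP => [->//|/eqP kj]; have /matrixP/(_ x k) := hN; rewrite !mxE => <-.
  by apply: eq_bigr => r _; rewrite hA'.
move: image_coord yj hN' hNA => y yj hN' hNA.
have -> : \sum_r N' i r * A' r k = if i == j
    then (\sum_r N j r * A' r k) / y j
    else \sum_r N i r * A' r k - y i / y j * \sum_r N j r * A' r k.
  case: eqP => ij; rewrite ?mulr_suml ?mulr_sumr -?sumrB; apply: eq_bigr => r _.
    by rewrite hN' ij eqxx; ring.
  by rewrite hN' (introF eqP ij); ring.
rewrite !hNA; case: (eqVneq i j) => [->|ij]; case: (eqVneq k j) => [e|kj].
- by rewrite divff.
- by rewrite mul0r.
- by rewrite e (negPf ij) mulfVK // subrr.
- by rewrite mulr0 subr0.
Qed.

End ColumnUpdate.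

Section Orientation.
Variables (R : realType) (d n : nat) (p : 'I_n -> 'rV[R]_d).

(** A vanishing determinant gives a linear dependence of the homogeneous columns: the row of ones
    says that its coefficients sum to 0, the other rows make it an affine dependence of the
    vertices. *)
Lemma orientation_neq0 (C : cell d n) :
  general_position p -> injective C -> orientation p C != 0.
Proof.
move=> hp hC; apply/negP => /eqP h0.
have /eqP/det0P[v v0 hv] : \det (orientation_matrix p C)^T = 0 by rewrite det_tr.
have hrow r : \sum_i v 0 i * homog (p (C i)) r 0 = 0.
  have /matrixP/(_ 0 r) := hv; rewrite !mxE => h; rewrite -[RHS]h.
  by apply: eq_bigr => i _; rewrite !mxE.
have hl : forall i, v 0 i = 0.
  apply: (hp C hC (fun i => v 0 i)).
    rewrite -[RHS](hrow ord_max); apply: eq_bigr => i _.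
    by rewrite mxE unlift_none mulr1.
  apply/rowP => k; rewrite summxE mxE -[RHS](hrow (lift ord_max k)).
  by apply: eq_bigr => i _; rewrite !mxE liftK.
by case/eqP: v0; apply/rowP => i; rewrite hl mxE.
Qed.

Definition homog_entry (a : 'I_n) (r : nat) : R :=
  if insub r is Some k then p a 0 k else 1.

Definition homog_operand (a : 'I_n) (r : nat) : operand R ('I_n * 'I_d) :=
  if insub r is Some k then Input R (a, k) else Const 1.

Lemma homog_entryE a (r : 'I_d.+1) : homog (p a) r 0 = homog_entry a r.
Proof.
rewrite mxE /homog_entry; case: unliftP => [k ->|->] /=.
  by rewrite /bump leqNgt ltn_ord add0n valK.
by rewrite insubF // ltnn.
Qed.

Lemma holds_homog s e m a r :
  holds (fun ij => p ij.1 0 ij.2) s e m (homog_operand a r) (homog_entry a r).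
Proof. by rewrite /homog_operand /homog_entry; case: insub. Qed.

Lemma replace_column C i a r k : k != i ->
  orientation_matrix p (replace C i a) r k = orientation_matrix p C r k.
Proof. by move=> h; rewrite !mxE ffunE (negPf h). Qed.

Lemma replaced_column C i a r :
  orientation_matrix p (replace C i a) r i = homog_entry a r.
Proof. by rewrite mxE ffunE eqxx homog_entryE. Qed.

End Orientation.

(** * Restoring the column order, and padding to a power of two *)

Definition column_perm n (sigma : nat -> nat) : 'S_n :=
  odflt 1%g [pick s : 'S_n | [forall i, s i == sigma i :> nat]].

Definition nat_permV n (s : 'S_n) (i : nat) : nat :=
  if insub i is Some i' then s^-1%g i' else 0%N.

Lemma nat_permV_ord n (s : 'S_n) (i : 'I_n) : nat_permV s i = s^-1%g i.
Proof. by rewrite /nat_permV valK. Qed.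

Lemma nat_permV_lt n (s : 'S_n) i : (i < n)%N -> (nat_permV s i < n)%N.
Proof. by move=> hi; rewrite -[i]/(nat_of_ord (Ordinal hi)) nat_permV_ord. Qed.

Section PermutedColumns.
Variable R : realType.

(** The chosen columns are distinct, since a repeated one would make two columns of the identity
    equal. Hence [sigma] is a permutation: its inverse reorders the rows of [x], and its sign
    corrects the determinant. *)
Lemma column_permP n (b x : nat -> nat -> R) (sigma : nat -> nat) :
  (forall k, (k < n)%N -> (sigma k < n)%N) ->
  nat_mx n n x *m nat_mx n n (fun i k => b i (sigma k)) = 1%:M ->
  let s := column_perm n sigma in
  nat_mx n n (fun i r => x (nat_permV s i) r) *m nat_mx n n b = 1%:M /\
  \det (nat_mx n n b) =
    \det (nat_mx n n (fun i k => b i (sigma k))) * (-1) ^+ s.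
Proof.
move=> hs hx s.
pose f (k : 'I_n) := Ordinal (hs k (ltn_ord k)).
have finj : injective f.
  move=> i k /(congr1 val) /= e.
  have /matrixP h := hx; have := h i i; rewrite !mxE eqxx => h1.
  have := h i k; rewrite !mxE.
  rewrite (eq_bigr (fun j => nat_mx n n x i j *
     nat_mx n n (fun i0 k0 => b i0 (sigma k0)) j i)); last first.
    by move=> j _; rewrite !mxE e.
  rewrite h1; case: eqP => // _ /eqP; by rewrite oner_eq0.
have hsig (k : 'I_n) : sigma k = s k.
  rewrite /s /column_perm; case: pickP => [t /forallP ht|h] /=; first exact/esym/eqP.
  have := h (perm finj); move/negbT/forallPn => [i]; rewrite permE /=.
  by rewrite eqxx.
have hcol : nat_mx n n (fun i k => b i (sigma k)) = col_perm s (nat_mx n n b).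
  by apply/matrixP => i k; rewrite !mxE hsig.
split.
  apply/matrixP => i k; rewrite !mxE.
  have /matrixP/(_ (s^-1%g i) (s^-1%g k)) := hx; rewrite !mxE.
  rewrite (inj_eq perm_inj) => <-; apply: eq_bigr => r _.
  by rewrite !mxE hsig permKV nat_permV_ord.
rewrite hcol col_permE det_mulmx det_perm odd_permV -mulrA -expr2 sqrr_sign.
by rewrite mulr1.
Qed.

(** The matrix [diag(b, 1)]: halving needs a size that is a power of two, and this extension keeps
    the determinant and has the inverse of [b] as a corner of its own inverse. *)
Definition pad_entry n (b : nat -> nat -> R) i k : R :=
  if (i < n)%N && (k < n)%N then b i k else (i == k)%:R.

Lemma pad_mx n e b :
  nat_mx (n + e) (n + e) (pad_entry n b) = block_mx (nat_mx n n b) 0 0 1%:M.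
Proof.
rewrite nat_mx_block; congr block_mx; apply/matrixP => i k; rewrite !mxE /pad_entry.
- by rewrite !ltn_ord.
- by rewrite [(n + _ < n)%N]ltnNge leq_addr andbF; case: eqP => //; have := ltn_ord i; lia.
- by rewrite [(n + _ < n)%N]ltnNge leq_addr; case: eqP => //; have := ltn_ord k; lia.
- by rewrite [(n + _ < n)%N]ltnNge leq_addr /= eqn_add2l.
Qed.

Lemma pad_inverse n n2 b x : (n <= n2)%N ->
  nat_mx n2 n2 x *m nat_mx n2 n2 (pad_entry n b) = 1%:M ->
  nat_mx n n x *m nat_mx n n b = 1%:M.
Proof.
move=> /subnKC <-; rewrite pad_mx nat_mx_block mulmx_block scalar_mx_block.
by move=> /eq_block_mx[+ _ _ _]; rewrite mulmx0 addr0.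
Qed.

Lemma det_pad n n2 b : (n <= n2)%N ->
  \det (nat_mx n2 n2 (pad_entry n b)) = \det (nat_mx n n b).
Proof. by move=> /subnKC <-; rewrite pad_mx det_ublock det1 mulr1. Qed.

Lemma pad_right_invertible n n2 b : (n <= n2)%N ->
  \det (nat_mx n n b) != 0 -> right_invertible n2 n2 (pad_entry n b).
Proof.
move=> hn h; exists (invmx (nat_mx n2 n2 (pad_entry n b))).
by rewrite mulmxV // unitmxE det_pad // unitfE.
Qed.

End PermutedColumns.

(** * Answering requests *)

Local Open Scope nat_scope.

Section Requests.
Variables (R : realType) (d n : nat).
Notation D := d.+1.
Notation block_size := (D * D).+1.
Notation J := ('I_n * 'I_d)%type.
Notation result := (operand R J * int)%type.

Definition coordinates (p : 'I_n -> 'rV[R]_d) (ij : J) : R := p ij.1 ord0 ij.2.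

(** The block of a cell holds the inverse of its orientation matrix, row by row,
    followed by the determinant. *)
Definition block_holds (p : 'I_n -> 'rV[R]_d) (m : memory R) base (C : cell d n) :=
  exists N : nat -> nat -> R,
  [/\ forall i r, i < D -> r < D -> m.[? base + (i * D + r)]%fmap = Some (N i r),
      (nat_mx D D N *m orientation_matrix p C = 1%:M)%R
    & m.[? base + D * D]%fmap = Some (orientation p C)].

Lemma block_holds_eq p (m m' : memory R) base C :
  (forall r, base <= r < base + block_size -> m'.[? r]%fmap = m.[? r]%fmap) ->
  block_holds p m base C -> block_holds p m' base C.
Proof.
move=> h [N [h1 h2 h3]]; exists N; split=> //; last by rewrite h //; lia.
by move=> i r hi hr; rewrite h ?h1 //; have := index_lt hi hr; lia.
Qed.

Definition answer (x : operand R J) : program R J result :=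
  SignTest x (fun z => Return R J (x, z)).

Lemma runs_answer inp (m : memory R) x c a b : value inp m x = Some c ->
  runs inp m (answer x) a b 1 (fun v m' => v = (x, sgz c) /\ m' = m).
Proof. by move=> h; exists (x, sgz c), m, 1; rewrite /= h. Qed.

Definition query base (i : 'I_D) (a : 'I_n) : program R J result :=
  bind (sum_of_products 0 1 D (fun l _ => Reg (base + (i * D + l))) (fun l _ => homog_operand R d a l))
  (fun=> bind (fill 1 1 (fun=> Mul) (fun=> Reg 0) (fun=> Reg (base + D * D)))
  (fun=> answer (Reg 1))).

Lemma runs_query p (m : memory R) base C i a : 2 <= base -> block_holds p m base C ->
  runs (coordinates p) m (query base i a) 0 2 (2 * D + 3) (fun v m' =>
    v = (Reg 1, sgz (orientation p (replace C i a))) /\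
    m'.[? 1]%fmap = Some (orientation p (replace C i a))).
Proof.
move=> hb [N [h1 h2 h3]].
have hdet : orientation p (replace C i a) =
    (\sum_(l < D) N i l * homog_entry p a l * orientation p C)%R.
  rewrite -mulr_suml mulrC /orientation.
  rewrite (det_column_update h2 (j := i)); last exact: replace_column.
  congr (_ * _)%R; apply: eq_bigr => r _.
  by rewrite mxE replaced_column.
apply: (runs_bind (T2 := 2) (runs_sum_of_products (s := 0) (n := 1) (N := D)
  (u := fun l _ => N i l) (v := fun l _ => homog_entry p a l) _)); try lia.
  move=> l k hl hk; split; last exact: holds_homog.
  by apply: holds_reg; [lia|exact: h1].
move=> _ m1 ho1 hs.
apply: (runs_bind (T2 := 1) (runs_fill (dst := 1)
  (u := fun=> (\sum_(l < D) N i l * homog_entry p a l)%R) (v := fun=> orientation p C)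
  (c := fun=> orientation p (replace C i a)) _)); try lia.
  move=> k hk; split.
  - by apply: holds_reg; [lia|rewrite (hs 0)].
  - by apply: holds_reg; [lia|rewrite ho1 //; lia].
  - by rewrite /= hdet mulr_suml.
move=> _ m2 ho2 hm2; have h := hm2 0 isT.
apply: (runs_weaken (runs_answer 0 2 (x := Reg 1) h)) => // v m' _ [-> ->].
by split.
Qed.

(** Registers [0] to [D - 1] receive the coordinates of the new column, the next [D] are scratch,
    and the next [D] receive the new row [j]. The block at [new] is written twice, first with the
    rank one correction (zero in row [j]), then with the new inverse. *)
Definition update base (j : 'I_D) (a : 'I_n) new : program R J unit :=
  bind (sum_of_products 0 D D (fun l i => Reg (base + (i * D + l))) (fun l _ => homog_operand R d a l))
  (fun=> bind (fill D (D + D) (fun=> Div) (fun r => Reg (base + (j * D + r))) (fun=> Reg j))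
  (fun=> bind (fill (D * D) new (fun=> Mul)
    (fun t => if t %/ D == j then Const 0%R else Reg (t %/ D))
    (fun t => Reg (D + D + t %% D)))
  (fun=> bind (fill (D * D) new (fun=> Sub)
    (fun t => if t %/ D == j then Reg (D + D + t %% D) else Reg (base + t))
    (fun t => Reg (new + t)))
  (fun=> fill 1 (new + D * D) (fun=> Mul) (fun=> Reg (base + D * D)) (fun=> Reg j))))).

Lemma runs_update p (m : memory R) base C j a new :
  3 * D <= base -> base + block_size <= new -> block_holds p m base C ->
  orientation p (replace C j a) != 0%R ->
  runs (coordinates p) m (update base j a new) 0 (new + block_size)
    (4 * (D * D) + 2 * D + 1) (fun _ m' =>
    block_holds p m' new (replace C j a) /\
    forall r, 3 * D <= r < new -> m'.[? r]%fmap = m.[? r]%fmap).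
Proof.
move=> hb hn [N [h1 h2 h3]] hne.
pose y i := (\sum_(l < D) N i l * homog_entry p a l)%R.
have hy i : y (nat_of_ord i) = image_coord (orientation_matrix p (replace C j a)) (nat_mx D D N) j i.
  by apply: eq_bigr => r _; rewrite mxE replaced_column.
have hdet : orientation p (replace C j a) = (orientation p C * y j)%R.
  rewrite /orientation (det_column_update h2 (j := j)); last exact: replace_column.
  by rewrite hy.
have yj : y j != 0%R by apply: contraNneq hne => e; rewrite hdet e mulr0.
have hlt i r : i < D -> r < D -> i * D + r < D * D by exact: index_lt.
have hj := ltn_ord j.
apply: (runs_bind (T2 := D + (D * D + (D * D + 1))) (runs_sum_of_products (s := 0) (n := D) (N := D)
  (u := fun l i => N i l) (v := fun l _ => homog_entry p a l) _)).
- move=> l i hl hi; split; last exact: holds_homog.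
  by apply: holds_reg; [lia|exact: h1].
- lia.
- lia.
2: lia.
move=> _ m1 ho1 hm1.
have k1 i r : i < D -> r < D -> m1.[? base + (i * D + r)]%fmap = Some (N i r).
  by move=> hi hr; rewrite ho1 ?h1 //; lia.
have k3 : m1.[? base + D * D]%fmap = Some (orientation p C) by rewrite ho1 //; lia.
have ky i : i < D -> m1.[? i]%fmap = Some (y i) by move=> hi; rewrite -[i]add0n hm1.
apply: (runs_bind (T2 := D * D + (D * D + 1)) (runs_fill (dst := D + D)
  (u := fun r => N j r) (v := fun=> y j) (c := fun r => (N j r / y j)%R) _)).
- move=> r hr; split; last by rewrite /= (negPf yj).
  + by apply: holds_reg; [lia|exact: k1].
  + by apply: holds_reg; [lia|exact: ky].
- lia.
- lia.
2: lia.
move=> _ m2 ho2 hz.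
have {}k1 i r : i < D -> r < D -> m2.[? base + (i * D + r)]%fmap = Some (N i r).
  by move=> hi hr; rewrite ho2 ?k1 //; lia.
have {}k3 : m2.[? base + D * D]%fmap = Some (orientation p C) by rewrite ho2 //; lia.
have {}ky i : i < D -> m2.[? i]%fmap = Some (y i).
  by move=> hi; rewrite ho2 ?ky //; lia.
pose w i r : R := if i == j :> nat then 0%R else (y i * (N j r / y j))%R.
apply: (runs_bind (T2 := D * D + 1) (runs_fill (dst := new)
  (u := fun t => if (t %/ D)%N == j then 0%R else y (t %/ D)%N)
  (v := fun t => (N j (t %% D)%N / y j)%R) (c := fun t => w (t %/ D)%N (t %% D)%N) _)).
- move=> t ht; have hi := div_lt ht; have hr := mod_lt ht.
  split.
  + case: eqP => _; first exact: holds_const.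
    by apply: holds_reg; [lia|exact: ky].
  + by apply: holds_reg; [lia|exact: hz].
  + by rewrite /= /w; case: eqP => _ //; rewrite mul0r.
- lia.
- lia.
2: lia.
move=> _ m3 ho3 hw.
pose N' i r : R := if i == j :> nat then (N j r / y j)%R
  else (N i r - y i * (N j r / y j))%R.
apply: (runs_bind (T2 := 1) (runs_fill (dst := new)
  (u := fun t => if (t %/ D)%N == j then (N j (t %% D)%N / y j)%R else N (t %/ D)%N (t %% D)%N)
  (v := fun t => w (t %/ D)%N (t %% D)%N) (c := fun t => N' (t %/ D)%N (t %% D)%N) _)).
- move=> t ht; have hi := div_lt ht; have hr := mod_lt ht.
  split.
  + case: eqP => _.
      by apply: holds_reg; [lia|rewrite ho3 ?hz //; lia].
    apply: holds_reg; first lia.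
    rewrite ho3; last by lia.
    by rewrite {1}(divn_eq t D) k1.
  + by apply: holds_reg; [lia|exact: hw].
  + by rewrite /= /w /N'; case: eqP => _ //; rewrite subr0.
- lia.
- lia.
2: lia.
move=> _ m4 ho4 hN'.
apply: (runs_weaken (runs_fill (dst := new + D * D) (u := fun=> orientation p C)
  (v := fun=> y j) (c := fun=> orientation p (replace C j a)) _)) => //.
- move=> i hi; split; last by rewrite /= hdet.
  + by apply: holds_reg; [lia|rewrite ho4 ?ho3 ?k3 //; lia].
  + by apply: holds_reg; [lia|rewrite ho4 ?ho3 ?ky //; lia].
- lia.
move=> _ m5 ho5 hD; split; last first.
  by move=> r hr; rewrite ho5 ?ho4 ?ho3 ?ho2 ?ho1 //; lia.
exists N'; split.
- move=> i r hi hr; have hl := hlt i r hi hr.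
  rewrite ho5; last by lia.
  by rewrite hN' // divn_index // modn_index.
- apply: (inverse_column_update h2 (j := j)).
  + exact: replace_column.
  + by rewrite -hy.
  + by move=> i r; rewrite !mxE -!hy /N'.
- by rewrite -[new + _]addn0 hD.
Qed.

End Requests.

Local Open Scope ring_scope.

Local Open Scope nat_scope.

(** * Request histories *)

Section History.
Variables (R : realType) (d n : nat).
Notation D := d.+1.

Definition source (q : request d n) : cell d n :=
  match q with Initial C => C | Replace C _ _ => C end.

(** In the order of first occurrence, so that the position of a cell, which
    determines the address of its block, does not change with later requests. *)
Definition sources (rs : seq (request d n)) : seq (cell d n) :=
  rev (undup (rev (map source rs))).

Definition moves (rs : seq (request d n)) : seq (cell d n * 'I_D * 'I_n) :=
  pmap (fun q => if q is Replace C i a then Some (C, i, a) else None) rs.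

Definition moved (f : cell d n * 'I_D * 'I_n) : cell d n := replace f.1.1 f.1.2 f.2.

Lemma sources_rcons rs q : sources (rcons rs q) =
  if source q \in sources rs then sources rs else rcons (sources rs) (source q).
Proof.
rewrite /sources map_rcons rev_rcons /= !mem_rev mem_undup mem_rev.
by case: ifP => // _; rewrite rev_cons.
Qed.

Lemma mem_sources rs C : (C \in sources rs) = (C \in map source rs).
Proof. by rewrite mem_rev mem_undup mem_rev. Qed.

Lemma sources_uniq rs : uniq (sources rs).
Proof. by rewrite rev_uniq undup_uniq. Qed.

Lemma mem_sources_cat rs rs' C :
  (C \in sources (rs ++ rs')) = (C \in sources rs) || (C \in sources rs').
Proof. by rewrite !mem_sources map_cat mem_cat. Qed.

Lemma moves_rcons_replace rs C i a :
  moves (rcons rs (Replace C i a)) = rcons (moves rs) (C, i, a).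
Proof. by rewrite /moves -cats1 pmap_cat /= cats1. Qed.

(** Either the cell has been used, so that its block exists, or it was the target of a request and
    is one column away from a cell that was used. *)
Definition reached rs C := C \in sources rs \/ exists2 f, f \in moves rs & moved f = C.

(** All that the evaluator needs to know of an incremental run; the geometry enters only through
    [incremental_consistent]. *)
Inductive consistent : seq (request d n) -> Prop :=
  | consistent_initial (C : cell d n) : injective C -> consistent [:: Initial C]
  | consistent_rcons rs (C : cell d n) i a :
      consistent rs -> injective C -> reached rs C ->
      consistent (rcons rs (Replace C i a)).

Lemma reached_rcons rs (C C' : cell d n) i a : reached rs C -> reached (rcons rs (Replace C' i a)) C.
Proof.
case=> [h|[f hf e]]; [left|right].
  by rewrite -cats1 mem_sources_cat h.
by exists f; rewrite // moves_rcons_replace mem_rcons inE hf orbT.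
Qed.

(** The last conclusion is the source of the factor [t] in the space: blocks belong to used cells,
    and these are cells of the triangulation. *)
Lemma incremental_consistent (p : 'I_n -> 'rV[R]_d) rs S (T : {set cell d n}) :
  incremental p rs S T ->
  [/\ consistent rs, forall C, C \in T -> injective C /\ reached rs C
    & forall C, C \in sources rs -> C \in T].
Proof.
elim=> {rs S T} [C hC|rs S T a fs T' _ [hrs hT hsrc] _ hfs hvis hT' htri].
  split; first exact: consistent_initial.
    by move=> C' /set1P ->; split=> //; left; rewrite mem_sources inE eqxx.
  by move=> C'; rewrite mem_sources inE => /eqP ->; apply/set1P.
have hTT' C : C \in T -> C \in T' by move=> h; apply/hT'; left.
have [hc hr hs] : [/\ consistent (rs ++ [seq Replace f.1 f.2 a | f <- fs]),
    forall C, reached rs C -> reached (rs ++ [seq Replace f.1 f.2 a | f <- fs]) C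
  & forall C, C \in sources (rs ++ [seq Replace f.1 f.2 a | f <- fs]) -> C \in T].
  elim/last_ind: fs hfs {hvis} => [|fs f IH] hfs; first by rewrite cats0.
  have [|hc hr hs] := IH.
    by move=> g hg; apply: hfs; rewrite mem_rcons inE hg orbT.
  have hf : f.1 \in T by apply: hfs; rewrite mem_rcons inE eqxx.
  have [hi hf'] := hT _ hf.
  rewrite map_rcons -rcons_cat; split.
  - by apply: consistent_rcons => //; apply: hr.
  - by move=> C /hr; apply: reached_rcons.
  - move=> C; rewrite sources_rcons /=; case: ifP => _; first exact: hs.
    by rewrite mem_rcons inE => /orP[/eqP ->|/hs].
split=> //; last by move=> C /hs/hTT'.
move=> C hC; have [hinj _ _ _] := htri; split; first by case: (hinj C hC).
(* A new cell comes from a visible boundary facet, whose predicate had to be requested at this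
   insertion. *)
have /hT'[h|[C' [i [hC' hb hv ->]]]] := hC; first by apply: hr; case: (hT C h).
right; exists (C', i, a) => //.
rewrite /moves pmap_cat mem_cat; apply/orP; right.
have := hvis _ _ hC' hb hv; elim: fs {hvis hfs hc hr hs} => //= f fs IH.
rewrite !inE => /orP[/eqP <-|h]; first by rewrite eqxx.
by rewrite IH ?orbT.
Qed.

End History.

(** * The evaluator and its invariant *)

Section Evaluator.
Variables (R : realType) (d n k T S : nat).
Notation D := d.+1.
Notation block_size := (D * D).+1.
Notation J := ('I_n * 'I_d)%type.
Notation result := (operand R J * int)%type.
Variable pivot : nat -> (nat -> nat -> operand R J) -> program R J (nat -> nat).
Hypothesis hpivot : pivot_spec (2 ^ k) (2 ^ k) T S pivot.
Hypotheses (hD : D <= 2 ^ k) (hS : 2 ^ k * 2 ^ k < S).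

(** Blocks start beyond both work areas, which begin at register 0: that of [pivot], of size [S],
    and that of [update], of size [3 D]. *)
Definition base0 := S + 3 * D.

Definition initial_entry (C : cell d n) r i : operand R J :=
  if (r < D) && (i < D) then homog_operand R d (C (inord i)) r
  else Const (r == i)%:R%R.

(** The permutation is known at each leaf of the decision tree, so its sign enters as a constant and
    reordering the rows costs one copying operation (adding 0) per entry. *)
Definition initial (C : cell d n) : program R J result :=
  bind (pivot 0 (initial_entry C)) (fun sigma =>
  let s := column_perm (2 ^ k) sigma in
  bind (fill (D * D) base0 (fun=> Add)
    (fun t => Reg (nat_permV s (t %/ D) * 2 ^ k + t %% D)) (fun=> Const 0%R)) (fun=>
  bind (fill 1 (base0 + D * D) (fun=> Mul) (fun=> Reg (2 ^ k * 2 ^ k))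
    (fun=> Const ((-1) ^+ s)%R)) (fun=>
  answer (Reg (base0 + D * D))))).

Lemma runs_initial p (m : memory R) (C : cell d n) : orientation p C != 0%R ->
  runs (coordinates p) m (initial C) 0 (base0 + block_size) (T + (D * D + 2))
    (fun v m' =>
    [/\ v = (Reg (base0 + D * D), sgz (orientation p C)),
        m'.[? base0 + D * D]%fmap = Some (orientation p C)
      & block_holds p m' base0 C]).
Proof.
move=> hne; rewrite /initial; move: (2 ^ k) hD hS hpivot => n2 hD' hS' hpivot'.
pose b r i := homog_entry p (C (inord i)) r.
have hb : nat_mx D D b = orientation_matrix p C.
  by apply/matrixP => r i; rewrite [LHS]mxE [RHS]mxE homog_entryE /b inord_val.
have hS0 : base0 = S + 3 * D by [].
have hinv : right_invertible n2 n2 (pad_entry D b).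
  by apply: pad_right_invertible; rewrite // hb.
apply: (runs_bind (T2 := D * D + 2) (hpivot' (coordinates p) m 0 (initial_entry C) (pad_entry D b) hinv _)).
- move=> r i hr hi; rewrite /initial_entry /pad_entry; case: ifP => _.
    exact: holds_homog.
  exact: holds_const.
- by [].
- lia.
2: lia.
move=> sigma m1 ho1 [hsig [x [hx hxb hdet]]].
have [hinv1 hdet1] := column_permP hsig hxb.
set s := column_perm _ sigma; cbv zeta; rewrite -/s in hinv1 hdet1 *.
have hsb i : i < D -> nat_permV s i < n2.
  by move=> hi; apply: nat_permV_lt; apply: leq_trans hD'.
apply: (runs_bind (T2 := 2) (runs_fill (dst := base0)
  (u := fun t => x (nat_permV s (t %/ D)%N) (t %% D)%N) (v := fun=> 0%R)
  (c := fun t => x (nat_permV s (t %/ D)%N) (t %% D)%N) _)).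
- move=> t ht; have hi := hsb _ (div_lt ht).
  have hr : t %% D < n2 by apply: leq_trans (mod_lt ht) hD'.
  split=> //; last by rewrite /= addr0.
  by apply: holds_reg; [have := index_lt hi hr; lia|exact: hx].
- lia.
- lia.
2: lia.
move=> _ m2 ho2 hN.
apply: (runs_bind (T2 := 1) (runs_fill (dst := base0 + D * D)
  (u := fun=> (\det (nat_mx n2 n2 (fun i k0 => pad_entry D b i (sigma k0))))%R)
  (v := fun=> ((-1) ^+ s)%R) (c := fun=> orientation p C) _)).
- move=> i _; split=> //.
    by apply: holds_reg; [lia|rewrite ho2 ?hdet //; lia].
  by rewrite /= -hdet1 det_pad // hb.
- lia.
- lia.
2: by [].
move=> _ m3 ho3 hd; have hd0 : m3.[? base0 + D * D]%fmap = Some (orientation p C).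
  by rewrite -[base0 + _]addn0 hd.
apply: (runs_weaken (runs_answer 0 (base0 + block_size) (x := Reg (base0 + D * D)) hd0)) => //.
move=> v m' _ [-> ->]; split=> //.
exists (fun i r => x (nat_permV s i) r); split=> //.
- move=> i r hi hr; rewrite ho3; last by have := index_lt hi hr; lia.
  by rewrite hN ?index_lt // divn_index // modn_index.
- by rewrite -hb; apply: pad_inverse hD' hinv1.
Qed.

(** For a cell not yet in [L] the index is [size L], so the same formula gives the first free block,
    where the cell stays once appended. *)
Definition block_base (L : seq (cell d n)) C := base0 + index C L * block_size.

(** The branch is decided by the history alone. A cell used for the first time is rebuilt from the
    first request that had it as target; for a [consistent] history such a request exists. *)
Definition evaluate (rs : seq (request d n)) (q : request d n) : program R J result :=
  match q with
  | Initial C => initial C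
  | Replace C i a =>
      let L := sources rs in
      if C \in L then query R (block_base L C) i a
      else match [seq f <- moves rs | moved f == C] with
      | f :: _ => bind (update R (block_base L f.1.1) f.1.2 f.2 (block_base L C))
          (fun=> query R (block_base L C) i a)
      | [::] => Return R J (Const 0%R, 0%R)
      end
  end.

Definition pivoting_evaluator : evaluator R d n := fun rs =>
  if rev rs is q :: rs' then evaluate (rev rs') q else Return R J (Const 0%R, 0%R).

Lemma pivoting_evaluator_rcons rs q : pivoting_evaluator (rcons rs q) = evaluate rs q.
Proof. by rewrite /pivoting_evaluator rev_rcons revK. Qed.

(** By the last clause the cell behind any earlier request has its block, so one update suffices and
    no chain of missing cells has to be rebuilt. *)
Definition represents (p : 'I_n -> 'rV[R]_d) rs (m : memory R) :=
  [/\ forall C, C \in sources rs -> injective C /\ block_holds p m (block_base (sources rs) C) C,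
      forall r, base0 + size (sources rs) * block_size <= r -> m.[? r]%fmap = None
    & forall f, f \in moves rs -> f.1.1 \in sources rs].

Lemma block_base_lt (L : seq (cell d n)) C : C \in L ->
  block_base L C + block_size <= base0 + size L * block_size.
Proof.
move=> h; rewrite /block_base -addnA -mulSnr leq_add2l leq_mul2r.
by rewrite index_mem h orbT.
Qed.

Lemma block_base_rcons (L : seq (cell d n)) C C' : C \in L ->
  block_base (rcons L C') C = block_base L C.
Proof. by move=> h; rewrite /block_base -cats1 index_cat h. Qed.

Lemma block_base_new (L : seq (cell d n)) C : C \notin L ->
  block_base L C = base0 + size L * block_size.
Proof. by move=> h; rewrite /block_base memNindex. Qed.

Lemma block_base_last (L : seq (cell d n)) C : C \notin L ->
  block_base (rcons L C) C = base0 + size L * block_size.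
Proof.
by move=> h; rewrite /block_base -cats1 index_cat (negPf h) /= eqxx addn0.
Qed.

Lemma consistent_evaluates p rs : general_position p -> consistent rs ->
  exists t0 ts m, [/\ evaluates p pivoting_evaluator rs (t0 :: ts) m,
    t0 <= T + (D * D + 2),
    forall t, t \in ts -> t <= 4 * (D * D) + 4 * D + 4
  & represents p rs m].
Proof.
move=> hp; elim=> {rs} [C hC|rs C i a hrs [t0 [ts [m [hev ht0 hts [hL hfree hmv]]]]] hC hreach].
  have [v [m [t [hE ht ho [hv hd hbl]]]]] :=
    runs_initial [fmap]%fmap (orientation_neq0 hp hC).
  rewrite hv in hE.
  exists t, [::], m; split=> //.
    apply: (@evaluates_rcons _ _ _ p pivoting_evaluator [::] [::] [fmap]%fmap (Initial C)
      (Reg (base0 + D * D)) t m) => //; exact: evaluates_nil.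
  have hs : sources [:: Initial C] = [:: C] by [].
  split=> //; rewrite hs.
    by move=> C'; rewrite inE => /eqP ->; rewrite /block_base /= eqxx addn0.
  by move=> r; rewrite /= mul1n => hr; rewrite ho ?fnd_fmap0 // hr ?orbT.
have hb0 : 3 * D <= base0 by rewrite /base0; lia.
have hge C' : base0 <= block_base (sources rs) C' by rewrite /block_base leq_addr.
suff [v [m' [t [hE ht hv hd hrep]]]] : exists v m' t,
    [/\ exec (coordinates p) (evaluate rs (Replace C i a)) m = Some (v, m', t),
        t <= 4 * (D * D) + 4 * D + 4,
        v = (Reg 1, sgz (orientation p (replace C i a))),
        m'.[? 1]%fmap = Some (orientation p (replace C i a))
      & represents p (rcons rs (Replace C i a)) m'].
  rewrite hv in hE.
  exists t0, (rcons ts t), m'; split=> //.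
    apply: (@evaluates_rcons _ _ _ p pivoting_evaluator rs (t0 :: ts) m (Replace C i a)
      (Reg 1) t m') => //; by rewrite pivoting_evaluator_rcons.
  by move=> t'; rewrite mem_rcons inE => /orP[/eqP ->|/hts].
rewrite /represents moves_rcons_replace sources_rcons /= /evaluate.
case: ifP => hCL.
  have [_ hbl] := hL C hCL.
  have h2 : 2 <= block_base (sources rs) C by apply: leq_trans (hge C); lia.
  have [v [m' [t [hE ht ho [hv hd]]]]] := runs_query i a h2 hbl.
  exists v, m', t; split=> //; first lia.
  split.
  - move=> C' hC'; have [hi hbl'] := hL C' hC'; split=> //.
    apply: block_holds_eq hbl' => r hr; apply: ho.
    by have := hge C'; lia.
  - by move=> r hr; rewrite ho ?hfree //; lia.
  - by move=> f; rewrite mem_rcons inE => /orP[/eqP ->|/hmv].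
case: hreach => [|[f0 hf0 ef0]]; first by rewrite hCL.
case Ef: [seq f <- moves rs | moved f == C] => [|f fs].
  have : f0 \in [seq f <- moves rs | moved f == C] by rewrite mem_filter ef0 eqxx.
  by rewrite Ef.
have : f \in [seq f <- moves rs | moved f == C] by rewrite Ef inE eqxx.
rewrite mem_filter => /andP[/eqP ef hf].
have hfL := hmv f hf; have [_ hblf] := hL _ hfL.
have hlt := block_base_lt hfL.
rewrite -(block_base_new (negbT hCL)) in hlt.
have hne : orientation p (replace f.1.1 f.1.2 f.2) != 0%R.
  by rewrite -/(moved f) ef; apply: orientation_neq0.
have hru := @runs_update R d n p m _ f.1.1 f.1.2 f.2 (block_base (sources rs) C)
  (leq_trans hb0 (hge _)) hlt hblf hne.
have [v [m' [t [hE ht ho [hv hd [hblC hold]]]]]] : runs (coordinates p) m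
  (bind (update R (block_base (sources rs) f.1.1) f.1.2 f.2 (block_base (sources rs) C))
          (fun=> query R (block_base (sources rs) C) i a))
   0 (block_base (sources rs) C + block_size) (4 * (D * D) + 4 * D + 4)
   (fun v m' => [/\ v = (Reg 1, sgz (orientation p (replace C i a))),
      m'.[? 1]%fmap = Some (orientation p (replace C i a)) &
      block_holds p m' (block_base (sources rs) C) C /\
      forall r, 3 * D <= r < block_base (sources rs) C -> m'.[? r]%fmap = m.[? r]%fmap]).
  apply: (runs_bind (T2 := 2 * D + 3) hru) => //; last lia.
  rewrite -/(moved f) ef => _ m1 ho1 [hb1 hk1].
  have h2 : 2 <= block_base (sources rs) C by apply: leq_trans (hge C); lia.
  apply: (runs_weaken (runs_query i a h2 hb1)) => //; first lia.
  move=> v m2 ho2 [hv hd]; split=> //; split.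
    by apply: block_holds_eq hb1 => r hr; apply: ho2; lia.
  by move=> r hr; rewrite ho2 ?hk1 //; lia.
exists v, m', t; split=> //; split.
- move=> C'; rewrite mem_rcons inE; case: (eqVneq C' C) => [->|ne] /= hC'.
    split=> //; rewrite block_base_last ?(negbT hCL) //.
    by rewrite -(block_base_new (negbT hCL)).
  have [hi hbl'] := hL C' hC'; split=> //; rewrite block_base_rcons //.
  apply: block_holds_eq hbl' => r hr; apply: hold.
  have h1 := hge C'; have h2 := block_base_lt hC'.
  rewrite -(block_base_new (negbT hCL)) in h2; lia.
- move=> r; rewrite size_rcons mulSnr addnA -(block_base_new (negbT hCL)) => hr.
  have hr' : base0 + size (sources rs) * block_size <= r.
    by rewrite -(block_base_new (negbT hCL)); lia.
  by rewrite ho ?hfree // hr ?orbT.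
- move=> g; rewrite !mem_rcons !inE => /orP[/eqP ->|/hmv h]; first by rewrite eqxx.
  by rewrite h orbT.
Qed.

Lemma represents_space p rs m : represents p rs m ->
  space_used m <= base0 + size (sources rs) * block_size.
Proof.
move=> [_ hfree _]; rewrite -(size_iota 0 (base0 + _)).
apply: uniq_leq_size; first exact: fset_uniq.
move=> r hr; rewrite mem_iota add0n /= ltnNge; apply/negP => /hfree.
by rewrite (in_fnd hr).
Qed.

End Evaluator.

Local Open Scope ring_scope.

(** * The bounds with an absolute constant *)

Theorem proposition2 (R : realType) (omega : R) (homega : 2 < omega)
    (hmul : matmul_exponent omega) :
  exists K : R, forall (d n : nat), (0 < d)%N ->
  exists ev : evaluator R d n,
  forall p : 'I_n -> 'rV[R]_d, injective p -> general_position p ->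
  forall (rs : seq (request d n)) (T : {set cell d n}),
    incremental p rs [set: 'I_n]%SET T ->
  exists (t0 : nat) (ts : seq nat) (m : memory R),
    [/\ evaluates p ev rs (t0 :: ts) m,
        t0%:R <= K * d%:R `^ omega,
        forall t, t \in ts -> t%:R <= K * d%:R ^+ 2
      & (space_used m)%:R <= K * d%:R ^+ 2 * #|T|%:R].
Proof.
have [K0 K00 hK0] := fast_pivot homega hmul.
have W4 := four_lt_W homega; set W : R := 2 `^ omega in W4.
(* From [2^k <= 4 d], the first inversion costs at most [K0 W^2 d^omega] and uses at most
   [16 K0 d^2] registers. The 28 is [16 + 8 + 4], from [4 D^2 + 4 D + 4] with [D <= 2 d]. *)
exists (K0 * W ^+ 2 + 16 * K0 + 28) => d n d0.
pose D := d.+1; pose k := (trunc_log 2 D).+1.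
have /andP[hk1 hk2] : (2 ^ trunc_log 2 D <= D < 2 ^ k)%N by apply: trunc_log_bounds.
have hk : (2 ^ k <= 4 * d)%N by rewrite /k expnS; move: hk1; rewrite /D; lia.
have [T [S [pivot [hpivot hmS hT hS]]]] := hK0 ('I_n * 'I_d)%type k k (leqnn k).
exists (pivoting_evaluator k S pivot) => p _ hp rs TT /incremental_consistent[hrs _ hsrc].
have [t0 [ts [m [hev ht0 hts hrep]]]] :=
  consistent_evaluates hpivot (ltnW hk2) hmS hp hrs.
have hsz : (size (sources rs) <= #|TT|)%N.
  rewrite cardE; apply: uniq_leq_size (sources_uniq rs) _ => C /hsrc.
  by rewrite mem_enum.
(* At least one cell exists, so the work space of the first inversion is absorbed in [d^2 t]. *)
have hsz1 : (0 < size (sources rs))%N.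
  case: (sources rs) hsrc (mem_sources rs) => // _ hm.
  case: hrs hm => [C _|rs' C i a _ _ _] /(_ C).
    by rewrite in_nil mem_head.
  by rewrite in_nil map_rcons mem_rcons mem_head.
have d1 : 1 <= d%:R :> R by rewrite ler1n.
have dd : d%:R <= d%:R ^+ 2 :> R by rewrite expr2; nra.
have hkR : 2 ^+ k <= 4 * d%:R :> R by rewrite -natrX -natrM ler_nat.
have hd2 : d%:R ^+ 2 <= d%:R `^ omega :> R.
  by rewrite -powR_mulrn ?ler0n // ler_powR // ltW.
have hWk : W ^+ k <= W ^+ 2 * d%:R `^ omega.
  rewrite /W -!pow2_omega -powRM ?ler0n // ge0_ler_powR ?nnegrE ?ler0n ?mulr_ge0 //.
    by apply: ltW; lra.
  by rewrite -natrM ler_nat.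
have hDd : (D <= d + d)%N by rewrite /D -addn1 leq_add2l.
have hDD : (D * D <= 4 * (d * d))%N.
  by apply: leq_trans (leq_mul hDd hDd) _; rewrite addnn -mul2n mulnACA.
have hDR : (D * D)%:R <= 4 * d%:R ^+ 2 :> R.
  by rewrite expr2 -!natrM ler_nat.
have W0 : 0 <= W ^+ 2 by rewrite exprn_ge0 //; lra.
set x : R := d%:R ^+ 2 in dd hd2 hDR *; set z := d%:R `^ omega in hd2 hWk *.
have x1 : 1 <= x by lra.
have hKW : 0 <= K0 * W ^+ 2 by rewrite mulr_ge0.
exists t0, ts, m; split=> //.
- have : t0%:R <= T%:R + ((D * D)%:R + 2) :> R by rewrite -!natrD ler_nat.
  have e : 2 ^+ k * (W / 2) ^+ k = W ^+ k by rewrite -exprMn; congr (_ ^+ _); field.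
  rewrite e in hT.
  have h1 : K0 * W ^+ k <= K0 * (W ^+ 2 * z) by rewrite ler_wpM2l.
  have h2 : 0 <= K0 * z by rewrite mulr_ge0 //; lra.
  have -> : (K0 * W ^+ 2 + 16 * K0 + 28) * z =
    K0 * (W ^+ 2 * z) + 16 * (K0 * z) + 28 * z by ring.
  lra.
- move=> t /hts ht.
  have : t%:R <= (4 * (4 * (d * d)) + 4 * (d + d) + 4)%:R :> R.
    by rewrite ler_nat; apply: leq_trans ht _; rewrite leq_add2r leq_add // leq_mul2l.
  rewrite !(natrD, natrM) -expr2 -/x => h.
  have h1 : 0 <= (K0 * W ^+ 2 + 16 * K0) * x by rewrite mulr_ge0 ?addr_ge0 //; lra.
  have -> : (K0 * W ^+ 2 + 16 * K0 + 28) * x = (K0 * W ^+ 2 + 16 * K0) * x + 28 * x.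
    by ring.
  lra.
- have hsp := leq_trans (represents_space hrep) (leq_add (leqnn _)
    (leq_mul hsz (leqnn _))).
  set c : R := #|TT|%:R.
  have c1 : 1 <= c by rewrite ler1n (leq_trans hsz1 hsz).
  have : (space_used m)%:R <= S%:R + 3 * (2 * d%:R) + c * ((D * D)%:R + 1) :> R.
    have : (space_used m <= S + 3 * (2 * d) + #|TT| * (D * D + 1))%N.
      apply: leq_trans hsp _; rewrite /base0 addn1 leq_add2r leq_add2l leq_mul2l /= mul2n -addnn.
      exact: hDd.
    by rewrite -(ler_nat R) !(natrD, natrM).
  have hSR : S%:R <= 16 * K0 * x.
    apply: le_trans hS _; have -> : 16 * K0 * x = K0 * ((4 * d%:R) * (4 * d%:R)).
      by rewrite /x; ring.
    rewrite ler_wpM2l // ler_pM // exprn_ge0 //; lra.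
  have h1 : c * ((D * D)%:R + 1) <= c * (5 * x) by rewrite ler_wpM2l //; lra.
  have hxc : x <= x * c by rewrite ler_peMr //; lra.
  have h2 : 16 * K0 * x <= 16 * K0 * (x * c) by rewrite ler_wpM2l //; lra.
  have h3 : 0 <= K0 * W ^+ 2 * (x * c) by rewrite mulr_ge0 // mulr_ge0; lra.
  have -> : (K0 * W ^+ 2 + 16 * K0 + 28) * x * c =
    K0 * W ^+ 2 * (x * c) + 16 * K0 * (x * c) + 28 * (x * c) by ring.
  lra.
Qed.
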